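(* Let $\lambda=(\lambda_1,\lambda_2,\lambda_3)$, $\gamma=(\gamma_1,\gamma_2,\gamma_3)$, $\mu=(\mu_1,\mu_2,\mu_3)$ be weakly decreasing triples of nonnegative integers with the same total sum and with $\lambda\succ\gamma\succ\mu$. Put $P_{\lambda,\gamma,\mu}=J_\lambda+J_\mu-2J_\gamma$ and $$Q(t)=\sum_{i=1}^3 t^{\lambda_i}+\sum_{i=1}^3 t^{\mu_i}-2\sum_{i=1}^3 t^{\gamma_i}.$$ Then $P_{\lambda,\gamma,\mu}(x,y,z)\ge 0$ for all real $x,y,z>0$ if and only if $Q(t)\ge 0$ for all real $t>0$.
   Context: For a triple $\eta=(\eta_1,\eta_2,\eta_3)$ of nonnegative integers, the labeled orbit sum is $J_\eta(x_1,x_2,x_3)=\sum_{\sigma\in S_3}\prod_{i=1}^3 x_i^{\eta_{\sigma(i)}}$ (all six permutations are counted, also when exponents repeat). For weakly decreasing triples $a,b$ with the same total sum, $a\succcurlyeq b$ means $a_1\ge b_1$ and $a_1+a_2\ge b_1+b_2$; $a\succ b$ means $a\succcurlyeq b$ and $a\ne b$. With these conventions $P_{\lambda,\gamma,\mu}(t,1,1)=2Q(t)$. *)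

(* Defs.v *)
From HB Require Import structures.
From mathcomp Require Import all_boot all_order all_fingroup all_algebra.
From mathcomp Require Import reals.

Set Implicit Arguments.
Unset Strict Implicit.
Unset Printing Implicit Defensive.

Import Order.TTheory GRing.Theory Num.Theory.

Local Open Scope ring_scope.

Definition triple := (3.-tuple nat)%type.

Definition weakly_decreasing (a : triple) : bool := sorted geq a.

Definition triple_sum (a : triple) : nat := (\sum_(i < 3) tnth a i)%N.

(* Used only for weakly decreasing triples with the same sum, so the partial
   sums of length 3 need not be compared. Positions are numbered from 0. *)
Definition dominates (a b : triple) : bool :=
  (nth 0 b 0 <= nth 0 a 0)%N &&
  (nth 0 b 0 + nth 0 b 1 <= nth 0 a 0 + nth 0 a 1)%N.

Definition strictly_dominates (a b : triple) : bool :=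
  dominates a b && (a != b).

(* The sum runs over all six permutations, without identifying equal terms. *)
Definition labeled_orbit_sum (R : realType) (eta : triple) (x : 3.-tuple R) : R :=
  \sum_(s : 'S_3) \prod_(i < 3) tnth x i ^+ tnth eta (s i).

Definition Pfun (R : realType) (lambda gamma mu : triple) (x y z : R) : R :=
  labeled_orbit_sum lambda [tuple x; y; z] + labeled_orbit_sum mu [tuple x; y; z]
  - 2 * labeled_orbit_sum gamma [tuple x; y; z].

Definition Qfun (R : realType) (lambda gamma mu : triple) (t : R) : R :=
  \sum_(i < 3) t ^+ tnth lambda i + \sum_(i < 3) t ^+ tnth mu i
  - 2 * \sum_(i < 3) t ^+ tnth gamma i.

(* Main.v *)
Require Import Defs.
From HB Require Import structures.
From mathcomp Require Import all_boot all_order all_fingroup all_algebra.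
From mathcomp Require Import reals.
From mathcomp Require Import boolp classical_sets topology normedtype normed_module.
From mathcomp Require Import derive realfun sequences exp.
From mathcomp Require Import ring lra.

(** In logarithmic coordinates, after using homogeneity and symmetry, an orbit
    sum is a positive multiple of
    [K(eta) = p(eta) r(eta) - q_{k-1}(eta)], where [eta] has sum zero,
    [q_s(eta) = sum_i e^{s eta_i}], [p = q_k] and [r = q_{-1}]; up to
    inverting the variables and rescaling, [k >= 1]. The hypothesis on [Q] says
    that [q_s(lambda) + q_s(mu) >= 2 q_s(gamma)] for every real [s].

    The idea is to compare [lambda] and [mu] with [gamma] separately. There are
    [c1, c2 >= 0], determined by [gamma], such that the gradient at [gamma] of
    [G = K - p(gamma) r - c1 q_k - c2 q_{k+1/2}] vanishes, and [G] turns out to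
    be minimal at [gamma] among all points comparable with [gamma] in the
    dominance order. Adding the inequalities [G(lambda) >= G(gamma)] and
    [G(mu) >= G(gamma)] bounds [K(lambda) + K(mu) - 2 K(gamma)] below by a
    nonnegative combination of three values of [Q].

    The minimality of [G] is obtained by integrating along paths from [gamma],
    on which the sign of the derivative of [G] in a direction [e_i - e_j] is
    needed. In the mean [m] and half-gap [d] of the two coordinates this
    derivative is [2 e^{k m} phi(m, d)], with monotonicity properties of [phi] in
    [m] and in [d]. *)

Set Implicit Arguments.
Unset Strict Implicit.
Unset Printing Implicit Defensive.

Import Order.TTheory GRing.Theory Num.Theory.
Import numFieldNormedType.Exports.

Local Open Scope classical_set_scope.
Local Open Scope ring_scope.

(** * Derivatives *)

Section Calculus.
Variable R : realType.

(* Not a class, unlike [is_derive], so that proof search never replaces the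
   syntax-directed rules below. *)
Definition drv (x : R) (f : R -> R) (d : R) : Prop := is_derive x 1 f d.

Implicit Types (f g df dg : R -> R) (a b c d x : R).

Lemma drv_cst c x : drv x (fun=> c : R) 0.
Proof. exact: is_derive_cst. Qed.

Lemma drv_id x : drv x (fun u : R => u) 1.
Proof. exact: is_derive_id. Qed.

Lemma drvD f g a b x : drv x f a -> drv x g b ->
  drv x (fun u => f u + g u) (a + b).
Proof. by move=> fa gb; exact: (is_deriveD fa gb). Qed.

Lemma drvN f a x : drv x f a -> drv x (fun u => - f u) (- a).
Proof. by move=> fa; exact: (is_deriveN fa). Qed.

Lemma drvM f g a b x : drv x f a -> drv x g b ->
  drv x (fun u => f u * g u) (a * g x + f x * b).
Proof.
move=> fa gb; have := is_deriveM fa gb.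
by rewrite /GRing.scale /= addrC [g x * a]mulrC.
Qed.

Lemma drv_expR f a x : drv x f a ->
  drv x (fun u => expR (f u)) (a * expR (f x)).
Proof.
move=> fa; have h := @is_derive1_comp _ expR f x _ _ (is_derive_expR (f x)) fa.
by rewrite mulrC in h.
Qed.

Lemma drv_pow r x : 0 < x -> drv x (fun u => u `^ r) (r * x `^ (r - 1)).
Proof. by move=> x0; apply: is_derive1_powR. Qed.

Lemma drvV f a x : f x != 0 -> drv x f a ->
  drv x (fun u => (f u)^-1) (- a * (f x) ^- 2).
Proof.
move=> f0 [fx dfx]; split; first exact: derivableV.
by rewrite deriveV// dfx /GRing.scale /= mulrC mulNr mulrN.
Qed.

Lemma drv_eq f a b x : drv x f a -> a = b -> drv x f b.
Proof. by move=> h <-. Qed.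

Lemma drv_continuous f df a b :
  (forall x, a <= x <= b -> drv x f (df x)) ->
  {within `[a, b]%classic, continuous f}.
Proof.
move=> fd; apply: derivable_within_continuous => x.
by rewrite in_itv /= => /fd [].
Qed.

Lemma drv_MVT f df a b : a < b ->
  (forall x, a <= x <= b -> drv x f (df x)) ->
  exists2 c, a < c < b & f b - f a = df c * (b - a).
Proof.
move=> ab fd.
have fdo x : x \in `]a, b[ -> drv x f (df x).
  by rewrite in_itv /= => /andP[ax xb]; apply: fd; rewrite !ltW.
have [c] := MVT ab fdo (drv_continuous fd).
by rewrite in_itv /= => cab e; exists c.
Qed.

Lemma drv_ge0_le f df a b : a <= b ->
  (forall x, a <= x <= b -> drv x f (df x)) ->
  (forall x, a <= x <= b -> 0 <= df x) -> f a <= f b.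
Proof.
rewrite le_eqVlt => /predU1P[->//|ab] fd df0.
have [c /andP[ac cb] e] := drv_MVT ab fd.
rewrite -subr_ge0 e mulr_ge0 ?subr_ge0 ?(ltW ab)// df0// (ltW ac) (ltW cb)//.
Qed.

Lemma drv_Rolle f df a b : a < b ->
  (forall x, a <= x <= b -> drv x f (df x)) -> f a = f b ->
  exists2 c, a < c < b & df c = 0.
Proof.
move=> ab fd e; have [c cab] := drv_MVT ab fd; rewrite e subrr => /esym/eqP.
rewrite mulf_eq0 subr_eq0 (gt_eqF ab) orbF => /eqP; by exists c.
Qed.

End Calculus.

Ltac drv_rule := first
  [ apply: drv_cst | apply: drv_id | apply: drvD | apply: drvN
  | apply: drvM | apply: drv_expR | apply: drv_pow | apply: drvV ].
Ltac drv := repeat (lazymatch goal with |- drv _ _ _ => drv_rule end).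
(* Leaves the equation between the computed and the claimed derivative last. *)
Ltac drvc := apply: drv_eq; [drv | cbv beta].

(** * Hyperbolic sine *)

Section HyperbolicSine.
Variable R : realType.
Implicit Types a b d e u x : R.
Local Notation E := (@expR R).

Definition sh u := (E u - E (- u)) / 2.

Lemma drv_sh (f : R -> R) a x : drv x f a ->
  drv x (fun u => sh (f u)) (a * ((E (f x) + E (- f x)) / 2)).
Proof.
move=> fa; rewrite /sh; apply: drv_eq; first by drv; exact: fa.
by cbv beta; field.
Qed.

Lemma sh0 : sh 0 = 0. Proof. by rewrite /sh oppr0 subrr mul0r. Qed.

Lemma sh_ge0 u : 0 <= u -> 0 <= sh u.
Proof.
by move=> u0; rewrite divr_ge0// subr_ge0 ler_expR; lra.
Qed.

Lemma sh_gt0 u : 0 < u -> 0 < sh u.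
Proof.
by move=> u0; rewrite divr_gt0// subr_gt0 ltr_expR; lra.
Qed.

Lemma ch_le u v : 0 <= u -> u <= v -> E u + E (- u) <= E v + E (- v).
Proof.
move=> u0 uv.
apply: (@drv_ge0_le R (fun t => E t + E (- t)) (fun t => E t - E (- t)) u v) => //.
  by move=> t _; drvc; ring.
by move=> t /andP[ut _]; rewrite subr_ge0 ler_expR; lra.
Qed.

Lemma ch_ge2 u : 0 <= u -> 2 <= E u + E (- u).
Proof.
move=> u0; have := ch_le (lexx 0) u0; rewrite oppr0 !expR0; lra.
Qed.

Lemma sh_superlinear l u : 1 <= l -> 0 <= u -> l * sh u <= sh (l * u).
Proof.
move=> l1 u0; rewrite -subr_ge0.
have -> : 0 = sh (l * 0) - l * sh 0 by rewrite !(mulr0, sh0) subrr.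
apply: (@drv_ge0_le R (fun u => sh (l * u) - l * sh u)
  (fun u => l * ((E (l * u) + E (- (l * u))) - (E u + E (- u))) / 2)) => //.
  by move=> t _; rewrite /sh; drvc; field.
move=> t /andP[t0 _]; rewrite divr_ge0// mulr_ge0// ?subr_ge0 ?ch_le//; nra.
Qed.

(** The quotient [sh (a t) / sh (b t)] increases with [t]. The numerator [N] of its derivative
    vanishes at 0 and has derivative [(a^2 - b^2) sh (a t) sh (b t) >= 0]. *)
Lemma sh_ratio a b d e : 0 <= b -> b <= a -> 0 < d -> d <= e ->
  sh (a * d) * sh (b * e) <= sh (a * e) * sh (b * d).
Proof.
rewrite le_eqVlt => /predU1P[<- _ _ _|b0 ba d0 de]; first by rewrite !mul0r sh0 !mulr0.
have a0 : 0 < a by lra.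
have bd : 0 < sh (b * d) by apply: sh_gt0; nra.
have be : 0 < sh (b * e) by apply: sh_gt0; nra.
suff : sh (a * d) / sh (b * d) <= sh (a * e) / sh (b * e).
  by rewrite ler_pdivrMr// mulrAC ler_pdivlMr.
pose N t := a * ((E (a * t) + E (- (a * t))) / 2) * sh (b * t)
  - b * ((E (b * t) + E (- (b * t))) / 2) * sh (a * t).
have N0 t : 0 <= t -> 0 <= N t.
  move=> t0; have -> : 0 = N 0 by rewrite /N !mulr0 sh0 !mulr0 subrr.
  apply: (@drv_ge0_le R N
    (fun t => (a ^+ 2 - b ^+ 2) * sh (a * t) * sh (b * t))) => //.
    by move=> u _; rewrite /N /sh; drvc; field.
  move=> u /andP[u0 _]; have [ua ub] : 0 <= a * u /\ 0 <= b * u by split; nra.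
  have ab : 0 <= a ^+ 2 - b ^+ 2 by rewrite subr_sqr mulr_ge0; lra.
  by apply: mulr_ge0; [apply: mulr_ge0|]; rewrite ?sh_ge0.
apply: (@drv_ge0_le R (fun t => sh (a * t) / sh (b * t))
  (fun t => N t / sh (b * t) ^+ 2)) => //.
- move=> t /andP[dt _]; have bt : sh (b * t) != 0 by rewrite gt_eqF// sh_gt0//; nra.
  apply: drv_eq.
    apply: drvM; first by apply: drv_sh; drv.
    by apply: drvV; [exact: bt|apply: drv_sh; drv].
  by cbv beta; rewrite /N; field.
- move=> t /andP[dt _]; rewrite divr_ge0 ?sqr_ge0// N0//; lra.
Qed.

(** Here [(1 - e^(-b t)) / (1 - e^(-a t))] increases with [t]. Up to positive factors its derivative
    is [N], which vanishes at 0 and has derivative [a b (e^(a t) - e^(b t))]. *)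
Lemma expm1_ratio a b d e : 0 <= b -> b <= a -> 0 < d -> d <= e ->
  (1 - E (- (a * e))) * (1 - E (- (b * d))) <=
  (1 - E (- (a * d))) * (1 - E (- (b * e))).
Proof.
rewrite le_eqVlt => /predU1P[<- _ _ _|b0 ba d0 de].
  by rewrite !mul0r !oppr0 !expR0 !subrr !mulr0.
have a0 : 0 < a by lra.
have p c t : 0 < c -> 0 < t -> 0 < 1 - E (- (c * t)).
  by move=> c0 t0; rewrite subr_gt0 -[ltRHS]expR0 ltr_expR oppr_lt0 mulr_gt0.
have e0 : 0 < e by lra.
suff : (1 - E (- (b * d))) / (1 - E (- (a * d))) <=
       (1 - E (- (b * e))) / (1 - E (- (a * e))).
  by rewrite ler_pdivrMr ?p// mulrAC ler_pdivlMr ?p// mulrC [leRHS]mulrC.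
pose N t := b * (E (a * t) - 1) - a * (E (b * t) - 1).
have N0 t : 0 <= t -> 0 <= N t.
  move=> t0; have -> : 0 = N 0 by rewrite /N !mulr0 expR0 subrr !mulr0 subrr.
  apply: (@drv_ge0_le R N (fun t => a * b * (E (a * t) - E (b * t)))) => //.
    by move=> u _; rewrite /N; drvc; ring.
  move=> u /andP[u0 _]; apply: mulr_ge0; first by rewrite mulr_ge0; lra.
  by rewrite subr_ge0 ler_expR ler_wpM2r.
apply: (@drv_ge0_le R (fun t => (1 - E (- (b * t))) / (1 - E (- (a * t))))
  (fun t => N t * E (- (a * t)) * E (- (b * t)) / (1 - E (- (a * t))) ^+ 2)) => //.
- move=> t /andP[dt _]; have at0 : 1 - E (- (a * t)) != 0 by rewrite gt_eqF// p//; lra.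
  apply: drv_eq; first by apply: drvM; [drv|apply: drvV; [exact: at0|drv]].
  cbv beta.
  have -> : N t * E (- (a * t)) * E (- (b * t)) = b * (1 - E (- (a * t))) * E (- (b * t))
      - a * (1 - E (- (b * t))) * E (- (a * t)).
    rewrite /N; have := expRxMexpNx_1 (a * t); have := expRxMexpNx_1 (b * t).
    by move=> h1 h2; ring: h1 h2.
  by field.
- move=> t /andP[dt _]; rewrite divr_ge0 ?sqr_ge0// !mulr_ge0 ?expR_ge0// N0//; lra.
Qed.

End HyperbolicSine.

(** * The directional derivative [phi] *)

Section PairGradient.
Variable R : realType.
Variables k c1 c2 P : R.
Hypothesis k_gt1 : 1 < k.
Local Notation E := (@expR R).
Local Notation th := (k + 1 / 2).
Implicit Types d e m x : R.

Definition phi m d : R :=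
  k * (E (2 * m) - c1) * sh (k * d) + (k + 1) * E (- m) * sh ((k + 1) * d)
  - (P * E (- ((k + 1) * m)) - E (- ((3 * k + 1) * m))) * sh d
  - c2 * th * E (m / 2) * sh (th * d).

(** Sum-to-product formula around [th], the midpoint of [k] and [k + 1]. The term [sh (k d)] cancels
    when quotients by [sh (k d)] are compared at two half-gaps, as the term with [c1] does. *)
Lemma sh_succ d :
  sh ((k + 1) * d) = (E (d / 2) + E (- (d / 2))) * sh (th * d) - sh (k * d).
Proof.
have -> : (k + 1) * d = th * d + d / 2 by field.
have -> : k * d = th * d - d / 2 by field.
rewrite /sh !opprD !opprK !expRD; by field.
Qed.

Let sh_inc_coef m : E (m / 2) = E (- m) * E (3 / 2 * m).
Proof. by rewrite -expRD; congr expR; field. Qed.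

Let sh_dec_coef m : P * E (- ((k + 1) * m)) - E (- ((3 * k + 1) * m))
  = E (- ((k + 1) * m)) * (P - E (- (2 * k * m))).
Proof.
by rewrite mulrBr mulrC -expRD; congr (_ - expR _); ring.
Qed.

Let phi_ratio_diff m d e : phi m e * sh (k * d) - phi m d * sh (k * e) =
  (k + 1) * E (- m) * ((E (e / 2) + E (- (e / 2))) * sh (th * e) * sh (k * d)
    - (E (d / 2) + E (- (d / 2))) * sh (th * d) * sh (k * e))
  + E (- ((k + 1) * m)) * (P - E (- (2 * k * m)))
    * (sh d * sh (k * e) - sh e * sh (k * d))
  - E (- m) * (c2 * th * E (3 / 2 * m))
    * (sh (th * e) * sh (k * d) - sh (th * d) * sh (k * e)).
Proof. by rewrite /phi sh_dec_coef sh_inc_coef !sh_succ; ring. Qed.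

Let sh1_ratio d e : 0 < d -> d <= e ->
  0 <= sh d * sh (k * e) - sh e * sh (k * d).
Proof.
have k1 := k_gt1; move=> d0 de; rewrite subr_ge0.
have := @sh_ratio R k 1 d e ler01 (ltW k1) d0 de.
by rewrite !mul1r [leLHS]mulrC [leRHS]mulrC.
Qed.

Let sh_th_ratio d e : 0 < d -> d <= e ->
  0 <= sh (th * e) * sh (k * d) - sh (th * d) * sh (k * e).
Proof.
have k1 := k_gt1; move=> d0 de; rewrite subr_ge0; apply: sh_ratio => //; lra.
Qed.

(** The quotient of [phi m] by [sh (k d)] grows from [d] to [e], so nonnegativity passes to larger
    half-gaps and nonpositivity to smaller ones. In [phi_ratio_diff] the first bracket is at least
    [e^(e/2) + e^(-e/2)] times the last one, which the bound on [c2] then absorbs. *)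
Lemma phi_ratio_ch m d e : 0 < d -> d <= e -> E (- (2 * k * m)) <= P ->
  c2 * th * E (3 / 2 * m) <= (k + 1) * (E (e / 2) + E (- (e / 2))) ->
  phi m d * sh (k * e) <= phi m e * sh (k * d).
Proof.
have k1 := k_gt1; move=> d0 de PE c2b; rewrite -subr_ge0 phi_ratio_diff.
have X0 := sh_th_ratio d0 de; have Y0 := sh1_ratio d0 de.
have ch0 : 0 <= E (e / 2) + E (- (e / 2)) - (E (d / 2) + E (- (d / 2))).
  by rewrite subr_ge0 ch_le//; lra.
have T0 : 0 <= sh (th * d) * sh (k * e).
  by rewrite mulr_ge0// sh_ge0//; apply: mulr_ge0; lra.
have Em := expR_gt0 (- m); have Ek := expR_gt0 (- ((k + 1) * m)).
set Ce := (X in (k + 1) * X) in c2b ch0 *.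
set Cd := (E (d / 2) + _) in ch0 *.
set X := (_ - sh (th * d) * sh (k * e)) in X0 *.
have -> : Ce * sh (th * e) * sh (k * d) - Cd * sh (th * d) * sh (k * e)
    = Ce * X + (Ce - Cd) * (sh (th * d) * sh (k * e)) by rewrite /X; ring.
set Y := (sh d * _ - _) in Y0 *.
have -> : (k + 1) * E (- m) * (Ce * X + (Ce - Cd) * (sh (th * d) * sh (k * e)))
    + E (- ((k + 1) * m)) * (P - E (- (2 * k * m))) * Y
    - E (- m) * (c2 * th * E (3 / 2 * m)) * X
  = E (- m) * ((k + 1) * Ce - c2 * th * E (3 / 2 * m)) * X
    + (k + 1) * E (- m) * (Ce - Cd) * (sh (th * d) * sh (k * e))
    + E (- ((k + 1) * m)) * (P - E (- (2 * k * m))) * Y by ring.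
have E1 : 0 <= (k + 1) * E (- m) by rewrite mulr_ge0 ?(ltW Em)//; lra.
rewrite -subr_ge0 in c2b; rewrite -subr_ge0 in PE.
rewrite !addr_ge0//; apply: mulr_ge0 => //; apply: mulr_ge0 => //; exact: ltW.
Qed.

(* [sh (th d) = e^{d/2} G d] with [G / sh (k .)] decreasing, so that the first
   bracket of [phi_ratio_diff] is at least [2 e^{d/2}] times the last one; the
   excess contains the square [(e^{e/2} - e^{d/2})^2]. *)
Lemma phi_ratio_exp m d e : 0 < d -> d <= e -> E (- (2 * k * m)) <= P ->
  c2 * th * E (3 / 2 * m) <= 2 * (k + 1) * E (d / 2) ->
  phi m d * sh (k * e) <= phi m e * sh (k * d).
Proof.
have k1 := k_gt1; move=> d0 de PE c2b; rewrite -subr_ge0 phi_ratio_diff.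
have X0 := sh_th_ratio d0 de; have Y0 := sh1_ratio d0 de.
have Em := expR_gt0 (- m); have Ek := expR_gt0 (- ((k + 1) * m)).
pose G t := E (- (t / 2)) * sh (th * t).
have Gk t : G t = E (k * t) / 2 * (1 - E (- ((2 * k + 1) * t))).
  have e1 : E (- (t / 2)) * E (th * t) = E (k * t).
    by rewrite -expRD; congr expR; field.
  have e2 : E (- (t / 2)) * E (- (th * t)) = E (k * t) * E (- ((2 * k + 1) * t)).
    by rewrite -!expRD; congr expR; field.
  by rewrite /G /sh mulrA mulrBr e1 e2; field.
have shk t : sh (k * t) = E (k * t) / 2 * (1 - E (- ((2 * k) * t))).
  have e1 : E (- (k * t)) = E (k * t) * E (- (2 * k * t)).
    by rewrite -!expRD; congr expR; ring.
  by rewrite /sh e1; field.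
have shG t : sh (th * t) = E (t / 2) * G t.
  by rewrite /G mulrA expRxMexpNx_1 [RHS]mul1r.
have Gr : G e * sh (k * d) <= G d * sh (k * e).
  rewrite !Gk !shk.
  have kk : 2 * k <= 2 * k + 1 by lra.
  have k0 : 0 <= 2 * k by lra.
  have := expm1_ratio k0 kk d0 de; rewrite -subr_ge0 => h.
  have {}h := mulr_ge0 (mulr_ge0 (expR_ge0 (k * d)) (expR_ge0 (k * e))) h.
  rewrite -subr_ge0 -(@pmulr_rge0 _ (4 : R))// (le_trans h)//.
  by rewrite le_eqVlt; apply/orP; left; apply/eqP; field.
have Ge : 0 <= G e * sh (k * d).
  apply: mulr_ge0; last by rewrite sh_ge0//; apply: mulr_ge0; lra.
  by rewrite /G mulr_ge0 ?expR_ge0// sh_ge0//; apply: mulr_ge0; lra.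
have q1 : 1 <= E (d / 2) by rewrite -[leLHS]expR0 ler_expR; lra.
have Ed : E (d / 2) * E (- (d / 2)) = 1 by rewrite expRxMexpNx_1.
have Ee : E (e / 2) * E (- (e / 2)) = 1 by rewrite expRxMexpNx_1.
set X := (_ - sh (th * d) * sh (k * e)) in X0 *.
set Y := (sh d * _ - _) in Y0 *.
set Z := ((E (e / 2) + _) * _ * _ - _).
have Z0 : 0 <= Z - 2 * E (d / 2) * X.
  have -> : Z - 2 * E (d / 2) * X =
      (E (e / 2) - E (d / 2)) ^+ 2 * (G e * sh (k * d))
      + (E (d / 2) ^+ 2 - 1) * (G d * sh (k * e) - G e * sh (k * d)).
    by rewrite /Z /X !shG; ring: Ed Ee.
  rewrite addr_ge0// mulr_ge0 ?sqr_ge0// subr_ge0//.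
  by rewrite expr2; nra.
have -> : (k + 1) * E (- m) * Z
    + E (- ((k + 1) * m)) * (P - E (- (2 * k * m))) * Y
    - E (- m) * (c2 * th * E (3 / 2 * m)) * X
  = E (- m) * (2 * (k + 1) * E (d / 2) - c2 * th * E (3 / 2 * m)) * X
    + (k + 1) * E (- m) * (Z - 2 * E (d / 2) * X)
    + E (- ((k + 1) * m)) * (P - E (- (2 * k * m))) * Y by ring.
have E1 : 0 <= (k + 1) * E (- m) by rewrite mulr_ge0 ?(ltW Em)//; lra.
rewrite -subr_ge0 in c2b; rewrite -subr_ge0 in PE.
by rewrite !addr_ge0//; apply: mulr_ge0 => //; apply: mulr_ge0 => //; exact: ltW.
Qed.

End PairGradient.

(** * Monotonicity of [phi] in the mean *)

Section PairGradientMean.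
Variable R : realType.
Variables k c1 c2 P : R.
Hypothesis k_gt1 : 1 < k.
Local Notation E := (@expR R).
Local Notation th := (k + 1 / 2).
Implicit Types d e m x : R.

(** The extremal case [3 m = d], with [c2] at its upper bound, of the estimate for the derivative of
    [phi] in [m]. The expression factors through [q], and bounding each exponential in [q] by its
    tangent at 0 leaves exactly 0. *)
Lemma phi_mean_critical d : 0 <= d ->
  0 <= 2 * k * sh (k * d) - (k + 1) * E (- d) * sh ((k + 1) * d)
    + 2 * E (- ((k + 1) * d)) * sh d
    - (k - 1) ^+ 2 / th * E (- (d / 2)) * sh (th * d).
Proof.
have k1 := k_gt1; move=> d0.
have th0 : th != 0 by rewrite gt_eqF//; lra.
pose q := 3 / 2 / th * E (2 * k * d) + (k - 1) / th * E (- d) + E (- (2 * d)) - 2.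
have q0 : 0 <= q.
  have h1 := ler_wpM2l (_ : 0 <= 3 / 2 / th) (expR_ge1Dx (2 * k * d)).
  have h2 := ler_wpM2l (_ : 0 <= (k - 1) / th) (expR_ge1Dx (- d)).
  have h3 := expR_ge1Dx (- (2 * d)).
  have t1 : 0 <= 3 / 2 / th by rewrite divr_ge0//; lra.
  have t2 : 0 <= (k - 1) / th by rewrite divr_ge0//; lra.
  have {}h1 := h1 t1; have {}h2 := h2 t2.
  have : 3 / 2 / th * (1 + 2 * k * d) + (k - 1) / th * (1 - d) + (1 - 2 * d) - 2 = 0.
    by field; rewrite gt_eqF//; lra.
  by rewrite /q; lra.
have -> : 2 * k * sh (k * d) - (k + 1) * E (- d) * sh ((k + 1) * d)
    + 2 * E (- ((k + 1) * d)) * sh d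
    - (k - 1) ^+ 2 / th * E (- (d / 2)) * sh (th * d)
  = (k - 1) / 2 * E (- (k * d)) * q.
  pose K := E (k * d); pose K' := E (- (k * d)); pose D := E (d / 2); pose D' := E (- (d / 2)).
  have KK : K * K' = 1 by rewrite expRxMexpNx_1.
  have DD : D * D' = 1 by rewrite expRxMexpNx_1.
  have e1 : E (- d) = D' ^+ 2 by rewrite expr2 -expRD; congr expR; field.
  have e2 : E ((k + 1) * d) = K * D ^+ 2 by rewrite expr2 -!expRD; congr expR; field.
  have e3 : E (- ((k + 1) * d)) = K' * D' ^+ 2.
    by rewrite expr2 -!expRD; congr expR; field.
  have e4 : E (th * d) = K * D by rewrite -!expRD; congr expR; field.
  have e5 : E (- (th * d)) = K' * D' by rewrite -!expRD; congr expR; field.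
  have e6 : E (2 * k * d) = K ^+ 2 by rewrite expr2 -!expRD; congr expR; field.
  have e7 : E (- (2 * d)) = D' ^+ 4.
    by rewrite [D' ^+ 4](exprM _ 2 2) !expr2 -!expRD; congr expR; field.
  have e8 : E d = D ^+ 2 by rewrite expr2 -!expRD; congr expR; field.
  rewrite /q /sh e1 e2 e3 e4 e5 e6 e7 e8 -/K -/K' -/D'.
  by field: KK DD; rewrite gt_eqF//; lra.
apply: mulr_ge0 => //; apply: mulr_ge0; last exact: expR_ge0.
by rewrite divr_ge0//; lra.
Qed.

(** The bounds on [P] and [c2] reduce the derivative in [m] to [e^(2m)] times an expression in
    [M = 3 m]. This is nonnegative at [M = d] by [phi_mean_critical], and [bern] together with
    [2 sh d <= sh ((k + 1) d)] carries it to all [M >= d]. *)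
Lemma phi_mean_nondecreasing m1 m2 d : 3 <= P -> 0 <= c2 ->
  c2 * th ^+ 2 <= 2 * (k - 1) ^+ 2 -> 0 <= d -> d <= 3 * m1 -> m1 <= m2 ->
  phi k c1 c2 P m1 d <= phi k c1 c2 P m2 d.
Proof.
have k1 := k_gt1; move=> P3 c20 c2b d0 dm m12.
have th0 : 0 < th by lra.
apply: (@drv_ge0_le R (fun m => phi k c1 c2 P m d) (fun m =>
  2 * k * E (2 * m) * sh (k * d) - (k + 1) * E (- m) * sh ((k + 1) * d)
  + ((k + 1) * P * E (- ((k + 1) * m)) - (3 * k + 1) * E (- ((3 * k + 1) * m))) * sh d
  - c2 * th / 2 * E (m / 2) * sh (th * d))) => //.
  by move=> m _; rewrite /phi; drvc; field.
move=> m /andP[m1m _].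
have m0 : 0 <= m by lra.
have s0 : 0 <= sh d by exact: sh_ge0.
have T0 : 0 <= sh (th * d) by apply: sh_ge0; apply: mulr_ge0; lra.
have S2 : 2 * sh d <= sh ((k + 1) * d).
  have h : 1 <= k + 1 by lra.
  by have := sh_superlinear h d0; nra.
have hP : 2 * E (- ((3 * k + 1) * m)) <=
    (k + 1) * P * E (- ((k + 1) * m)) - (3 * k + 1) * E (- ((3 * k + 1) * m)).
  have h : E (- ((3 * k + 1) * m)) <= E (- ((k + 1) * m)) by rewrite ler_expR; nra.
  have h0 := expR_gt0 (- ((3 * k + 1) * m)).
  have h1 : (k + 1) * 3 <= (k + 1) * P by rewrite ler_wpM2l//; lra.
  by nra.
have hc : c2 * th / 2 <= (k - 1) ^+ 2 / th.
  by rewrite ler_pdivlMr//; move: c2b; rewrite expr2; lra.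
have bern M : d <= M -> E (- ((k + 1) * d)) - E (- ((k + 1) * M))
    <= (k + 1) * (E (- d) - E (- M)).
  move=> dM; rewrite -subr_ge0.
  have -> : (k + 1) * (E (- d) - E (- M)) - (E (- ((k + 1) * d)) - E (- ((k + 1) * M)))
    = (E (- ((k + 1) * M)) - (k + 1) * E (- M))
      - (E (- ((k + 1) * d)) - (k + 1) * E (- d)) by ring.
  rewrite subr_ge0.
  apply: (@drv_ge0_le R (fun t => E (- ((k + 1) * t)) - (k + 1) * E (- t))
    (fun t => (k + 1) * (E (- t) - E (- ((k + 1) * t))))) => //.
    by move=> t _; drvc; ring.
  move=> t /andP[dt _]; rewrite mulr_ge0 ?subr_ge0 ?ler_expR//; nra.
have Q := phi_mean_critical d0.
have dM : d <= 3 * m by lra.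
have {bern}B := bern _ dM.
have Ehalf : E (- (3 * m / 2)) <= E (- (d / 2)) by rewrite ler_expR; lra.
have E3 : E (- (3 * m)) <= E (- d) by rewrite ler_expR; lra.
have main : 0 <= 2 * k * sh (k * d) - (k + 1) * E (- (3 * m)) * sh ((k + 1) * d)
    + 2 * E (- ((k + 1) * (3 * m))) * sh d
    - (k - 1) ^+ 2 / th * E (- (3 * m / 2)) * sh (th * d).
  have a1 : (k - 1) ^+ 2 / th * E (- (3 * m / 2)) * sh (th * d)
      <= (k - 1) ^+ 2 / th * E (- (d / 2)) * sh (th * d).
    by rewrite ler_wpM2r// ler_wpM2l// divr_ge0 ?sqr_ge0// ltW.
  have a2 : 2 * sh d * (E (- ((k + 1) * d)) - E (- ((k + 1) * (3 * m))))
     <= 2 * sh d * ((k + 1) * (E (- d) - E (- (3 * m)))) by rewrite ler_wpM2l// mulr_ge0.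
  have a3 : 2 * sh d * ((k + 1) * (E (- d) - E (- (3 * m))))
     <= sh ((k + 1) * d) * ((k + 1) * (E (- d) - E (- (3 * m)))).
    by rewrite ler_wpM2r// mulr_ge0 ?subr_ge0//; lra.
  lra.
have e1 : E (- m) = E (2 * m) * E (- (3 * m)) by rewrite -expRD; congr expR; field.
have e2 : E (m / 2) = E (2 * m) * E (- (3 * m / 2)) by rewrite -expRD; congr expR; field.
have e3 : E (- ((3 * k + 1) * m)) = E (2 * m) * E (- ((k + 1) * (3 * m))).
  by rewrite -expRD; congr expR; field.
have b1 : 2 * E (- ((3 * k + 1) * m)) * sh d <=
   ((k + 1) * P * E (- ((k + 1) * m)) - (3 * k + 1) * E (- ((3 * k + 1) * m))) * sh d.
  by rewrite ler_wpM2r.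
have b2 : c2 * th / 2 * E (m / 2) * sh (th * d)
    <= (k - 1) ^+ 2 / th * E (m / 2) * sh (th * d).
  by rewrite ler_wpM2r// ler_wpM2r// expR_ge0.
have := mulr_ge0 (expR_ge0 (2 * m)) main.
move: b1 b2; rewrite {1}e3 {2}e2 e1; lra.
Qed.

End PairGradientMean.

(** * Monotonicity of [phi] in the third coordinate *)

Section PairGradientThird.
Variable R : realType.
Variables k c1 c2 P : R.
Hypothesis k_gt1 : 1 < k.
Local Notation E := (@expR R).
Local Notation th := (k + 1 / 2).
Implicit Types d e m x : R.

(** Superlinearity of [sh] bounds the larger arguments below by multiples of [sh (k e)]. The last
    inequality then amounts to [(k + 1 - 2/(k + 1)) (k + 1)/k + (k - 1)^2/k = 2 k]. *)
Lemma sh_third_critical e : 0 <= e ->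
  [/\ 0 <= (k - 1) ^+ 2 / th * sh (th * e),
      (k - 1) ^+ 2 / th * sh (th * e) <= (k + 1) * sh ((k + 1) * e) - 2 * sh e &
      2 * k * sh (k * e) <= (k + 1) * sh ((k + 1) * e) - 2 * sh e
        + (k - 1) ^+ 2 / th * sh (th * e)].
Proof.
have k1 := k_gt1; move=> e0.
have [k0 th0 ke0] : [/\ 0 < k, 0 < th & 0 <= k * e] by split=> //; nra.
have kp : 0 < k + 1 by lra.
have s0 : 0 <= sh (k * e) by exact: sh_ge0.
have T0 : 0 <= sh (th * e) by apply: sh_ge0; nra.
have S0 : 0 <= sh ((k + 1) * e) by apply: sh_ge0; nra.
have l1 : 1 <= k + 1 by lra.
have l2 : 1 <= th / k by rewrite ler_pdivlMr//; lra.
have l3 : 1 <= (k + 1) / k by rewrite ler_pdivlMr//; lra.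
have l4 : 1 <= (k + 1) / th by rewrite ler_pdivlMr//; lra.
have h1 := sh_superlinear l1 e0.
have h2 := sh_superlinear l2 ke0.
have h3 := sh_superlinear l3 ke0.
have the0 : 0 <= th * e by nra.
have h4 := sh_superlinear l4 the0.
have q2 : th / k * (k * e) = th * e by rewrite mulrA divfK// gt_eqF.
have q3 : (k + 1) / k * (k * e) = (k + 1) * e by rewrite mulrA divfK// gt_eqF.
have q4 : (k + 1) / th * (th * e) = (k + 1) * e by rewrite mulrA divfK// gt_eqF.
rewrite q2 in h2; rewrite q3 in h3; rewrite q4 in h4.
have b0 : 0 <= (k - 1) ^+ 2 / th by rewrite divr_ge0 ?sqr_ge0// ltW.
have bk : (k - 1) ^+ 2 / th <= k - 1 by rewrite ler_pdivrMr//; nra.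
have sS : 2 * sh e <= 2 / (k + 1) * sh ((k + 1) * e).
  by rewrite mulrAC ler_pdivlMr//; lra.
split; first by rewrite mulr_ge0.
  have TS : sh (th * e) <= sh ((k + 1) * e).
    by rewrite (le_trans _ h4)// ler_peMl.
  have e1 : sh e <= sh ((k + 1) * e).
    by rewrite (le_trans _ h1)// ler_peMl// sh_ge0.
  have : (k - 1) ^+ 2 / th * sh (th * e) <= (k - 1) * sh ((k + 1) * e).
    by rewrite ler_pM.
  lra.
have g1 : (k - 1) ^+ 2 / th * (th / k * sh (k * e))
    <= (k - 1) ^+ 2 / th * sh (th * e) by rewrite ler_wpM2l.
have c0 : 0 <= k + 1 - 2 / (k + 1).
  by rewrite subr_ge0 ler_pdivrMr//; nra.
have g2 : (k + 1 - 2 / (k + 1)) * ((k + 1) / k * sh (k * e))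
    <= (k + 1 - 2 / (k + 1)) * sh ((k + 1) * e) by rewrite ler_wpM2l.
have : 2 * k * sh (k * e) = (k + 1 - 2 / (k + 1)) * ((k + 1) / k * sh (k * e))
    + (k - 1) ^+ 2 / th * (th / k * sh (k * e)).
  by field; rewrite !gt_eqF//; lra.
lra.
Qed.

(** A third coordinate [x] means that the other two have mean [- x / 2]. The bound on [P] makes the
    coefficient of [sh e] in the derivative at least [- e^(x/2)], and the one on [c2] controls the
    last term. What remains is half of [e^(-x) (a e^(3x/2) + b e^(-3x/4) - 2 k sh (k e))], handled
    by tangents at 0 and [sh_third_critical]. *)
Lemma phi_third_nondecreasing x1 x2 e : 0 <= x1 -> x1 <= x2 -> 0 <= e ->
  P <= 2 * E (k * x1) + E (- (k * x1 / 2)) ->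
  2 * (k - 1) ^+ 2 * E (- (3 / 2 * x1)) <= c2 * th ^+ 2 ->
  phi k c1 c2 P (- x1 / 2) e <= phi k c1 c2 P (- x2 / 2) e.
Proof.
have k1 := k_gt1; move=> x10 x12 e0 hP hc.
have th0 : 0 < th by lra.
apply: (@drv_ge0_le R (fun x => phi k c1 c2 P (- x / 2) e) (fun x =>
  - k * E (2 * (- x / 2)) * sh (k * e)
  + (k + 1) / 2 * E (- (- x / 2)) * sh ((k + 1) * e)
  + ((3 * k + 1) / 2 * E (- ((3 * k + 1) * (- x / 2)))
     - (k + 1) / 2 * P * E (- ((k + 1) * (- x / 2)))) * sh e
  + c2 * th / 4 * E (- x / 2 / 2) * sh (th * e))) => //.
  by move=> x _; rewrite /phi; drvc; field.
move=> x /andP[x1x _].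
have x0 : 0 <= x by lra.
pose r := E (k * x / 2); pose r' := E (- (k * x / 2)).
pose q := E (x / 4); pose q' := E (- (x / 4)).
have rr : r * r' = 1 by rewrite expRxMexpNx_1.
have qq : q * q' = 1 by rewrite expRxMexpNx_1.
have r1 : 1 <= r by rewrite -[leLHS]expR0 ler_expR; nra.
have r'0 : 0 < r' by exact: expR_gt0.
have q'0 : 0 < q' by exact: expR_gt0.
have q1 : 1 <= q by rewrite -[leLHS]expR0 ler_expR; lra.
(* The function [2 r^2 + 1/r] increases on [r >= 1], so the bound assumed at [x1] persists at
   [x]. *)
have {}hP : P <= 2 * r ^+ 2 + r'.
  apply: (le_trans hP).
  pose t := E (k * x1 / 2); pose t' := E (- (k * x1 / 2)).
  have tt : t * t' = 1 by rewrite expRxMexpNx_1.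
  have t1 : 1 <= t by rewrite -[leLHS]expR0 ler_expR; nra.
  have tr : t <= r by rewrite ler_expR; nra.
  have t'0 : 0 < t' by exact: expR_gt0.
  have -> : E (k * x1) = t ^+ 2 by rewrite expr2 -expRD; congr expR; field.
  rewrite -/t'.
  have t'1 : t' <= 1 by nra.
  have r'1 : r' <= 1 by nra.
  have : t' - r' = t' * r' * (r - t) by ring: tt rr.
  have : t' * r' <= 1 by nra.
  have : 0 <= r - t by lra.
  set w := r - t; set v := t' * r'.
  have -> : r = t + w by rewrite /w; ring.
  nra.
have e1 : E (2 * (- x / 2)) = q' ^+ 4.
  by rewrite [q' ^+ 4](exprM _ 2 2) !expr2 -!expRD; congr expR; field.
have e2 : E (- (- x / 2)) = q ^+ 2 by rewrite expr2 -!expRD; congr expR; field.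
have e3 : E (- ((3 * k + 1) * (- x / 2))) = r ^+ 3 * q ^+ 2.
  by rewrite exprS !expr2 -!expRD; congr expR; field.
have e4 : E (- ((k + 1) * (- x / 2))) = r * q ^+ 2.
  by rewrite expr2 -!expRD; congr expR; field.
have e5 : E (- x / 2 / 2) = q' by congr expR; field.
rewrite e1 e2 e3 e4 e5.
have [b0 ba ab] := sh_third_critical e0.
have br : - (q ^+ 2) <= (3 * k + 1) / 2 * (r ^+ 3 * q ^+ 2) - (k + 1) / 2 * P * (r * q ^+ 2).
  have h1 : (k + 1) / 2 * (r * q ^+ 2) * P <= (k + 1) / 2 * (r * q ^+ 2) * (2 * r ^+ 2 + r').
    rewrite ler_wpM2l// mulr_ge0 ?mulr_ge0 ?sqr_ge0//; lra.
  have h2 : (k + 1) / 2 * (r * q ^+ 2) * (2 * r ^+ 2 + r')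
     = (k + 1) * (r ^+ 3 * q ^+ 2) + (k + 1) / 2 * q ^+ 2 by field: rr.
  have h3 : 0 <= (k - 1) / 2 * (r ^+ 3 - 1) * q ^+ 2.
    rewrite mulr_ge0 ?sqr_ge0// mulr_ge0; [|by lra|by rewrite subr_ge0 exprn_ege1].
    by [].
  lra.
have cc : (k - 1) ^+ 2 / th * q' ^+ 6 <= c2 * th / 2.
  have : E (- (3 / 2 * x)) <= E (- (3 / 2 * x1)) by rewrite ler_expR; lra.
  have -> : E (- (3 / 2 * x)) = q' ^+ 6.
    by rewrite [q' ^+ 6](exprM _ 2 3) exprS !expr2 -!expRD; congr expR; field.
  move=> h; rewrite mulrAC ler_pdivrMr//.
  have := ler_wpM2l (_ : 0 <= 2 * (k - 1) ^+ 2) h.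
  rewrite mulr_ge0 ?sqr_ge0// => /(_ isT); move: hc; rewrite [th ^+ 2]expr2; lra.
set S := sh ((k + 1) * e) in ab ba *; set s := sh (k * e) in ab *.
set T := sh (th * e) in ab ba b0 *.
have s0 : 0 <= sh e by exact: sh_ge0.
have T0 : 0 <= T by apply: sh_ge0; nra.
have m1 := ler_wpM2r s0 br.
have m2 := ler_wpM2r (mulr_ge0 (ltW q'0) T0) cc.
set a := (k + 1) * S - 2 * sh e in ab ba.
set b := (k - 1) ^+ 2 / th * T in ab ba b0.
have M0 : 0 <= a * q ^+ 6 + b * q' ^+ 3 - 2 * k * s.
  have x6 : q ^+ 6 = E (3 / 2 * x).
    by rewrite [q ^+ 6](exprM _ 2 3) exprS !expr2 -!expRD; congr expR; field.
  have x3 : q' ^+ 3 = E (- (3 / 4 * x)).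
    by rewrite exprS !expr2 -!expRD; congr expR; field.
  have a0 : 0 <= a by lra.
  have := ler_wpM2l a0 (expR_ge1Dx (3 / 2 * x)).
  have := ler_wpM2l b0 (expR_ge1Dx (- (3 / 4 * x))).
  by rewrite x6 x3; nra.
have := mulr_ge0 (exprn_ge0 4 (ltW q'0)) M0.
have -> : q' ^+ 4 * (a * q ^+ 6 + b * q' ^+ 3 - 2 * k * s)
  = q ^+ 2 * a + b * q' ^+ 7 - 2 * k * q' ^+ 4 * s by ring: qq.
move: m1 m2; rewrite /a /b; lra.
Qed.

End PairGradientThird.

(** * Functions with three zeros *)

Section ThreeZeros.
Variable R : realType.
Variables (f f' f'' : R -> R) (y1 y2 y3 : R).
Hypotheses (y1_gt0 : 0 < y1) (y12 : y1 < y2) (y23 : y2 < y3).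
Hypothesis drv_f : forall x, 0 < x -> drv x f (f' x).
Hypothesis drv_f' : forall x, 0 < x -> drv x f' (f'' x).
Hypothesis f''_shape : forall p0 p1 p2, 0 < p0 -> p0 <= p1 -> p1 < p2 ->
  f'' p1 < 0 -> 0 < f'' p2 -> f'' p0 < 0.
Variable C : R.
Hypothesis f_near0 : forall u, 0 < u -> u <= 1 -> - (C * u) <= f u.
Hypotheses (f1 : f y1 = 0) (f2 : f y2 = 0) (f3 : f y3 = 0).

Let MVTf a b : 0 < a -> a < b ->
  exists2 c, a < c < b & f b - f a = f' c * (b - a).
Proof.
by move=> a0 ab; apply: drv_MVT => // x /andP[ax _]; apply: drv_f; exact: lt_le_trans ax.
Qed.

Let MVTf' a b : 0 < a -> a < b ->
  exists2 c, a < c < b & f' b - f' a = f'' c * (b - a).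
Proof.
by move=> a0 ab; apply: drv_MVT => // x /andP[ax _]; apply: drv_f'; exact: lt_le_trans ax.
Qed.

(* Up to [p1] the function [f] would be concave, hence below its tangent slope
   [f' t > 0] on [(0, y1)] and bounded away from [0] near [0]. *)
Let no_early_increase t p1 p2 : y1 <= t -> t <= p1 -> p1 < p2 ->
  0 < f' t -> f'' p1 < 0 -> 0 < f'' p2 -> False.
Proof.
have y10 := y1_gt0.
move=> y1t tp p12 ft f1n f2p.
have f'lb u : 0 < u -> u <= t -> f' t <= f' u.
  move=> u0; rewrite le_eqVlt => /predU1P[->//|ut].
  have [c /andP[uc ct] e] := MVTf' u0 ut.
  have c0 : 0 < c by lra.
  have cp : c <= p1 by lra.
  have := f''_shape c0 cp p12 f1n f2p; nra.
have ub u : 0 < u -> u <= y1 / 2 -> f u <= - (f' t * (y1 / 2)).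
  move=> u0 uy; have uy1 : u < y1 by lra.
  have [c /andP[uc cy] e] := MVTf u0 uy1.
  have c0 : 0 < c by lra.
  have ct : c <= t by lra.
  have := f'lb c c0 ct; rewrite f1 in e; nra.
pose w := f' t * (y1 / 2) / (2 * (`|C| + 1)).
have C0 : 0 <= `|C| by exact: normr_ge0.
have w0 : 0 < w by rewrite divr_gt0 ?mulr_gt0//; lra.
pose u := Num.min w (Num.min 1 (y1 / 2)).
have u0 : 0 < u by rewrite !lt_min w0/=; apply/andP; split; lra.
have uw : u <= w by rewrite ge_min lexx.
have u1 : u <= 1 by rewrite !ge_min lexx !orbT.
have uy : u <= y1 / 2 by rewrite !ge_min lexx !orbT.
have h1 := ub u u0 uy; have h2 := f_near0 u0 u1.
have h3 : C * u <= `|C| * w.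
  rewrite (le_trans (ler_norm _))// normrM (gtr0_norm u0) ler_wpM2l//.
have h4 : w * (2 * (`|C| + 1)) = f' t * (y1 / 2) by rewrite divfK// gt_eqF//; lra.
have : 0 < f' t * (y1 / 2) by rewrite mulr_gt0//; lra.
nra.
Qed.

(** A positive value at [y] would give, by the mean value theorem, points [t1 < t2 < t3] where [f']
    is positive, negative and zero. Then [f''] is negative before it is positive, which
    [no_early_increase] excludes. *)
Lemma three_zeros_le0 y : y1 < y -> y < y2 -> f y <= 0.
Proof.
have [y10 h12 h23] := And3 y1_gt0 y12 y23.
move=> y1y yy2; rewrite leNgt; apply/negP => fy.
have [y0 y20] : 0 < y /\ 0 < y2 by split; lra.
have [t1 /andP[a1 b1] e1] := MVTf y10 y1y.
have [t2 /andP[a2 b2] e2] := MVTf y0 yy2.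
have [t3 /andP[a3 b3] e3] := MVTf y20 h23.
rewrite f1 in e1; rewrite f2 in e2; rewrite f2 f3 in e3.
have t1p : 0 < f' t1 by nra.
have t2n : f' t2 < 0 by nra.
have t3z : f' t3 = 0 by nra.
have t12 : t1 < t2 by lra.
have t23 : t2 < t3 by lra.
have t10 : 0 < t1 by lra.
have t20 : 0 < t2 by lra.
have [p1 /andP[c1 d1] g1] := MVTf' t10 t12.
have [p2 /andP[c2 d2] g2] := MVTf' t20 t23.
apply: (@no_early_increase t1 p1 p2) => //; [lra|lra|lra|nra|nra].
Qed.

Lemma three_zeros_ge0 y : y2 < y -> y < y3 -> 0 <= f y.
Proof.
have [y10 h12 h23] := And3 y1_gt0 y12 y23.
move=> y2y yy3; rewrite leNgt; apply/negP => fy.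
have [y0 y20] : 0 < y /\ 0 < y2 by split; lra.
have [t1 /andP[a1 b1] e1] := MVTf y10 h12.
have [t2 /andP[a2 b2] e2] := MVTf y20 y2y.
have [t3 /andP[a3 b3] e3] := MVTf y0 yy3.
rewrite f1 f2 in e1; rewrite f2 in e2; rewrite f3 in e3.
have t1z : f' t1 = 0 by nra.
have t2n : f' t2 < 0 by nra.
have t3p : 0 < f' t3 by nra.
have t12 : t1 < t2 by lra.
have t23 : t2 < t3 by lra.
have t10 : 0 < t1 by lra.
have t20 : 0 < t2 by lra.
have [p1 /andP[c1 d1] g1] := MVTf' t10 t12.
have [p2 /andP[c2 d2] g2] := MVTf' t20 t23.
have n1 : f'' p1 < 0 by nra.
have n2 : 0 < f'' p2 by nra.
have p12 : p1 < p2 by lra.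
(* Here [f'] vanishes at [t1], so its positivity must be found further left: [f''] is negative
   between [y1] and [t1], hence [f' y1 > 0]. *)
have [p0 /andP[c0 d0] g0] := MVTf' y10 a1.
have p00 : 0 < p0 by lra.
have p01 : p0 <= p1 by lra.
have n0 := f''_shape p00 p01 p12 n1 n2.
apply: (@no_early_increase y1 p1 p2) => //; [lra|nra].
Qed.

End ThreeZeros.

(** * Interpolation at three points *)

Section Interpolation.
Variable R : realType.
Implicit Types (a b c k r x y u : R).

Lemma powR_shift x r s t : 0 < x -> r = s + t -> x `^ r = x `^ s * x `^ t.
Proof. by move=> x0 ->; rewrite powRD// (gt_eqF x0) implybT. Qed.

Lemma powR_shiftn x r s (n : nat) : 0 < x -> r = s + n%:R ->
  x `^ r = x `^ s * x ^+ n.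
Proof. by move=> x0 /(powR_shift x0) ->; rewrite powR_mulrn// ltW. Qed.

Definition ddiff2 (f : R -> R) a b c : R :=
  ((f c - f b) / (c - b) - (f b - f a) / (b - a)) / (c - a).

(** The mean value theorem on each half. The sign of a second divided difference thus follows from
    monotonicity of the first derivative. *)
Lemma ddiff2_slopes (f df : R -> R) a b c : 0 < a -> a < b -> b < c ->
  (forall x, 0 < x -> drv x f (df x)) ->
  exists u v, [/\ a < u, u < v, v < c &
    ddiff2 f a b c = (df v - df u) / (c - a)].
Proof.
move=> a0 ab bc fd.
have fda x : a <= x <= b -> drv x f (df x).
  by move=> /andP[ax _]; apply: fd; exact: lt_le_trans ax.
have fdb x : b <= x <= c -> drv x f (df x).
  by move=> /andP[bx _]; apply: fd; apply: lt_le_trans bx; exact: lt_trans ab.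
have [u /andP[au ub] eu] := drv_MVT ab fda.
have [v /andP[bv vc] ev] := drv_MVT bc fdb.
exists u, v; split => //; first exact: lt_trans bv.
by rewrite /ddiff2 eu ev !mulfK// subr_eq0 gt_eqF.
Qed.

Lemma ddiff2_pow_gt0 r a b c : 1 < r -> 0 < a -> a < b -> b < c ->
  0 < ddiff2 (fun y => y `^ r) a b c.
Proof.
move=> r1 a0 ab bc.
have [u [v [au uv vc ->]]] := ddiff2_slopes a0 ab bc (@drv_pow R r).
rewrite divr_gt0 ?subr_gt0 ?(lt_trans ab)// ltr_pM2l; last by lra.
by apply: gt0_ltr_powR => //; rewrite ?nnegrE; lra.
Qed.

(* The second derivative of [3 (r-2) y^r - r S y^{r-1} - C (y^3 - S y^2)] is
   [r (r-1) (r-2) (3 y - S) (y^{r-3} - (S/3)^{r-3})], and the cubic has second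
   divided difference [S - S = 0]. *)
Lemma ddiff2_pow_chebyshev r a b c : 3 < r -> 0 < a -> a < b -> b < c ->
  r * (a + b + c) * ddiff2 (fun y => y `^ (r - 1)) a b c <=
  3 * (r - 2) * ddiff2 (fun y => y `^ r) a b c.
Proof.
move=> r3 a0 ab bc; set S := a + b + c.
have S0 : 0 < S / 3 by rewrite /S; lra.
pose C := r * (r - 1) * (r - 2) / 2 * (S / 3) `^ (r - 3).
pose T y := 3 * (r - 2) * y `^ r - r * S * y `^ (r - 1)
  - C * (y * y * y - S * (y * y)).
pose dT y := 3 * (r - 2) * (r * y `^ (r - 1)) - r * S * ((r - 1) * y `^ (r - 1 - 1))
  - C * (3 * (y * y) - 2 * S * y).
have dTd x : 0 < x -> drv x T (dT x).
  by move=> x0; rewrite /T /dT; apply: drv_eq; [drv; exact: x0|cbv beta; ring].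
have dT_le u v : 0 < u -> u <= v -> dT u <= dT v.
  move=> u0 uv.
  apply: (@drv_ge0_le R dT (fun y => r * (r - 1) * (r - 2) * ((3 * y - S)
     * (y `^ (r - 3) - (S / 3) `^ (r - 3))))); first exact: uv.
    move=> y /andP[uy _]; have y0 : 0 < y by lra.
    rewrite /dT; apply: drv_eq; first by drv; exact: y0.
    cbv beta.
    rewrite (@powR_shiftn y (r - 1 - 1) (r - 3) 1)
      ?(@powR_shiftn y (r - 1 - 1 - 1) (r - 3) 0)//; try by ring.
    by rewrite /C; field.
  move=> y /andP[uy _]; have y0 : 0 < y by lra.
  have rr : 0 <= r * (r - 1) * (r - 2) by rewrite !mulr_ge0//; lra.
  apply: mulr_ge0 => //.
  have [yS|yS] := leP (S / 3) y.
    apply: mulr_ge0; first by lra.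
    by rewrite subr_ge0 ge0_ler_powR ?nnegrE//; lra.
  rewrite -mulrNN; apply: mulr_ge0; first by lra.
  by rewrite opprB subr_ge0 ge0_ler_powR ?nnegrE//; lra.
have [u [v [au uv vc e]]] := ddiff2_slopes a0 ab bc dTd.
have T0 : 0 <= ddiff2 T a b c.
  rewrite e divr_ge0 ?subr_ge0; [by []|apply: dT_le; lra|lra].
have cubic0 : ddiff2 (fun y => y * y * y - S * (y * y)) a b c = 0.
  rewrite /ddiff2 /S; field.
  by rewrite !subr_eq0 !gt_eqF// (lt_trans ab).
have Tlin : ddiff2 T a b c = 3 * (r - 2) * ddiff2 (fun y => y `^ r) a b c
    - r * S * ddiff2 (fun y => y `^ (r - 1)) a b c
    - C * ddiff2 (fun y => y * y * y - S * (y * y)) a b c.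
  by rewrite /ddiff2 /T; ring.
by move: T0; rewrite Tlin cubic0 mulr0 subr0 subr_ge0.
Qed.

End Interpolation.

(** * Existence and bounds of the interpolation parameters *)

Section InterpolationParameters.
Variable R : realType.
Implicit Types (k a b u x y : R).

(** At [y = e^(-u/2)], a zero means [(k - 1) e^((k-1) u) - al e^(k u) + be e^((k+1/2) u) = ka].
    Required for the three coordinates of [gamma], this is the stationarity of [G] on the plane of
    sum zero: [al] and [be] encode [c1] and [c2], and [ka] is the Lagrange multiplier up to sign. *)
Definition interp k ka al be y : R :=
  ka * y `^ (2 * k + 1) - (k - 1) * y ^+ 3 + al * y - be.

(** After division by [y^(2k+1)] the equation reads [Y y = ka], and Rolle gives two zeros of the
    cubic [psi]. Since [psi] has no quadratic term, these two zeros determine its remaining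
    coefficients. *)
Lemma interp_cubic k ka al be (y1 y2 y3 : R) : 1 < k ->
  0 < y1 -> y1 < y2 -> y2 < y3 ->
  interp k ka al be y1 = 0 -> interp k ka al be y2 = 0 ->
  interp k ka al be y3 = 0 ->
  exists e1 e2 : R, [/\ y1 < e1 < y2, y2 < e2 < y3,
    al * k = (k - 1) ^+ 2 * (e1 ^+ 2 + e1 * e2 + e2 ^+ 2) &
    be * (k + 1 / 2) = (k - 1) ^+ 2 * (e1 * e2 * (e1 + e2))].
Proof.
move=> k1 y10 y12 y23 z1 z2 z3.
pose Y y := (k - 1) * y `^ (- (2 * (k - 1))) - al * y `^ (- (2 * k))
  + be * y `^ (- (2 * k + 1)).
pose psi y := (k - 1) ^+ 2 * y ^+ 3 - al * k * y + be * (k + 1 / 2).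
have Yk y : 0 < y -> interp k ka al be y = 0 -> Y y = ka.
  move=> y0; rewrite /interp => z.
  have p0 : y `^ (2 * k + 1) != 0 by rewrite gt_eqF// powR_gt0.
  have pp : y `^ (- (2 * k + 1)) * y `^ (2 * k + 1) = 1 by rewrite powRN mulVf.
  rewrite /Y (@powR_shiftn R y (- (2 * (k - 1))) (- (2 * k + 1)) 3)//; last by ring.
  rewrite (@powR_shiftn R y (- (2 * k)) (- (2 * k + 1)) 1)//; last by ring.
  apply: (mulIf p0); rewrite -[RHS]subr0 -z; ring: pp.
have Yd y : 0 < y -> drv y Y (- 2 * psi y * y `^ (- (2 * k + 2))).
  move=> y0; rewrite /Y; apply: drv_eq; first by drv; exact: y0.
  cbv beta.
  rewrite (@powR_shiftn R y (- (2 * (k - 1)) - 1) (- (2 * k + 2)) 3)//; last by ring.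
  rewrite (@powR_shiftn R y (- (2 * k) - 1) (- (2 * k + 2)) 1)//; last by ring.
  rewrite (@powR_shiftn R y (- (2 * k + 1) - 1) (- (2 * k + 2)) 0)//; last by ring.
  by rewrite /psi; field.
have zero a b : 0 < a -> a < b -> interp k ka al be a = 0 -> interp k ka al be b = 0 ->
    exists2 e, a < e < b & psi e = 0.
  move=> a0 ab za zb.
  have Ydab y : a <= y <= b -> drv y Y (- 2 * psi y * y `^ (- (2 * k + 2))).
    by move=> /andP[ay _]; apply: Yd; exact: lt_le_trans ay.
  have Yab : Y a = Y b by rewrite !Yk//; exact: lt_trans ab.
  have [e /andP[ae eb] e0] := drv_Rolle ab Ydab Yab.
  exists e; first by rewrite ae.
  have pe : 0 < e `^ (- (2 * k + 2)) by apply: powR_gt0; exact: lt_trans ae.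
  by move/eqP: e0; rewrite !mulf_eq0 (gt_eqF pe) orbF oppr_eq0 pnatr_eq0 => /eqP.
have [e1 /andP[a1 b1] p1] := zero _ _ y10 y12 z1 z2.
have [e2 /andP[a2 b2] p2] := zero _ _ (lt_trans y10 y12) y23 z2 z3.
have e12 : e2 - e1 != 0 by rewrite subr_eq0 gt_eqF//; exact: lt_trans a2.
have eal : al * k = (k - 1) ^+ 2 * (e1 ^+ 2 + e1 * e2 + e2 ^+ 2).
  apply: (mulIf e12); move: p1 p2; rewrite /psi; lra.
exists e1, e2; split => //; rewrite ?a1 ?a2//.
by move: p1; rewrite /psi eal; lra.
Qed.

(** The second divided difference of the equation determines [ka], because that of [y^3] is [S] and
    that of an affine function is 0. The first one then gives [al], and the value at [y1] gives
    [be]. *)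
Lemma interp_exists k (y1 y2 y3 : R) : 1 < k ->
  0 < y1 -> y1 < y2 -> y2 < y3 -> y1 * y2 * y3 = 1 ->
  exists ka al be : R, [/\ interp k ka al be y1 = 0, interp k ka al be y2 = 0,
    interp k ka al be y3 = 0 & [/\ 0 <= ka,
    be <= (k - 1) * (y1 * y2 * (y1 + y2)), be * (k + 1 / 2) <= 2 * (k - 1) ^+ 2
    & al <= k * (y1 ^+ 2 + y2 ^+ 2 + y3 ^+ 2)]].
Proof.
move=> k1 y10 y12 y23 y123.
have [y20 y30] : 0 < y2 /\ 0 < y3 by split; lra.
pose n := 2 * k + 1.
pose N := ddiff2 (fun y => y `^ n) y1 y2 y3.
pose N' := ddiff2 (fun y => y `^ (n - 1)) y1 y2 y3.
pose S := y1 + y2 + y3.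
pose M := (y2 `^ n - y1 `^ n) / (y2 - y1).
have n3 : 3 < n by rewrite /n; lra.
have n1 : 1 < n by lra.
have N0 : 0 < N by exact: ddiff2_pow_gt0.
have S0 : 0 < S by rewrite /S; lra.
have N'N : n * S * N' <= 3 * (n - 2) * N by exact: ddiff2_pow_chebyshev.
have [d21 d32 d31] : [/\ y2 - y1 != 0, y3 - y2 != 0 & y3 - y1 != 0].
  by rewrite !subr_eq0 !gt_eqF//; lra.
pose ka := (k - 1) * S / N.
have kaN : ka * N = (k - 1) * S by rewrite divfK// gt_eqF.
pose al := (k - 1) * (y1 ^+ 2 + y1 * y2 + y2 ^+ 2) - ka * M.
pose be := ka * y1 `^ n - (k - 1) * y1 ^+ 3 + al * y1.
have MM : M * (y2 - y1) = y2 `^ n - y1 `^ n by rewrite divfK.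
have z1 : interp k ka al be y1 = 0 by rewrite /interp -/n /be; ring.
have z2 : interp k ka al be y2 = 0.
  have -> : interp k ka al be y2 = ka * (y2 `^ n - y1 `^ n - M * (y2 - y1)).
    by rewrite /interp -/n /be /al; ring.
  by rewrite MM subrr mulr0.
have NM : N * (y3 - y1) * (y3 - y2) = y3 `^ n - y2 `^ n - M * (y3 - y2).
  by rewrite /N /ddiff2 -/M divfK// mulrBl divfK.
have z3 : interp k ka al be y3 = 0.
  have e : ka * (y3 `^ n - y2 `^ n - M * (y3 - y2)) = (k - 1) * S * (y3 - y1) * (y3 - y2).
    by rewrite -NM -kaN; ring.
  by move: z2 e; rewrite /interp -/n /al /S; lra.
have pn y : 0 < y -> y `^ n = y `^ (n - 1) * y.
  by move=> y0; rewrite (@powR_shiftn R y n (n - 1) 1)//; ring.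
have ka0 : 0 <= ka by apply: divr_ge0; [apply: mulr_ge0; lra|exact: ltW].
have be_eq : be = (k - 1) * (y1 * y2 * (y1 + y2))
    - ka * (y1 * y2 * ((y2 `^ (n - 1) - y1 `^ (n - 1)) / (y2 - y1))).
  by rewrite /be /al /M !pn//; field.
have be_le : be <= (k - 1) * (y1 * y2 * (y1 + y2)).
  have h : 0 <= y2 `^ (n - 1) - y1 `^ (n - 1).
    by rewrite subr_ge0 ge0_ler_powR ?nnegrE//; lra.
  have h' : 0 <= y2 - y1 by lra.
  have y12p : 0 <= y1 * y2 by rewrite mulr_ge0// ltW.
  by rewrite be_eq gerBl; apply: mulr_ge0 => //; apply: mulr_ge0 => //; exact: divr_ge0.
exists ka, al, be; split => //; split => //.
(* Dividing the equation by [y] before taking second divided differences isolates [be], since [1/y]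
   has second divided difference [1/(y1 y2 y3) = 1]. [ddiff2_pow_chebyshev] then compares [N'] with
   [N]. *)
- have be_N' : be + (k - 1) = ka * N'.
    have zz y : 0 < y -> interp k ka al be y = 0 ->
        ka * y `^ (n - 1) = (k - 1) * y ^+ 2 - al + be / y.
      move=> y0; rewrite /interp -/n pn// => z.
      have yn0 : y != 0 by rewrite gt_eqF.
      by apply: (mulIf yn0); rewrite mulrDl divfK//; lra.
    have -> : ka * N' = ddiff2 (fun y => ka * y `^ (n - 1)) y1 y2 y3.
      by rewrite /N' /ddiff2; ring.
    rewrite /ddiff2 (zz _ y10 z1) (zz _ y20 z2) (zz _ y30 z3).
    have -> : be + (k - 1) = be / (y1 * y2 * y3) + (k - 1) by rewrite y123 divr1.
    by field; rewrite d21 d32 d31 !gt_eqF.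
  have h : n * S * (ka * N') <= 3 * (n - 2) * ((k - 1) * S).
    by rewrite -kaN; have := ler_wpM2l ka0 N'N; lra.
  have : n * (be + (k - 1)) <= 3 * (n - 2) * (k - 1).
    by rewrite -(ler_pM2r S0) be_N'; lra.
  by rewrite /n; lra.
- have p1 : 0 < y1 `^ n by exact: powR_gt0.
  have h : al * y1 <= (k - 1) * y1 * (y1 ^+ 2 + y2 * (y1 + y2)).
    by have := mulr_ge0 ka0 (ltW p1); move: be_le; rewrite /be; lra.
  have {}h : al <= (k - 1) * (y1 ^+ 2 + y2 * (y1 + y2)).
    by rewrite -(ler_pM2r y10); lra.
  have y13 : y1 * y2 <= y3 ^+ 2 by nra.
  have : (k - 1) * (y1 ^+ 2 + y2 * (y1 + y2)) <= (k - 1) * (y1 ^+ 2 + y2 ^+ 2 + y3 ^+ 2).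
    by rewrite ler_wpM2l//; lra.
  have : 0 <= y1 ^+ 2 + y2 ^+ 2 + y3 ^+ 2 by rewrite !addr_ge0// sqr_ge0.
  lra.
Qed.

End InterpolationParameters.

(** * Bounds for the interpolation function between its zeros *)

Section InterpolationLine.
Variable R : realType.
Implicit Types (k a b u x y : R).

(* With [c = (k - 1) / y3^(2k)], the difference of the two sides is a
   combination of [u^(2k+3), u^(2k+1), u^(2k), u, 1] vanishing at [y1, y2, y3],
   with second derivative [u^(2k-2)] times a concave cubic. *)
Lemma interp_line k ka al be (y1 y2 y3 : R) : 1 < k ->
  0 < y1 -> y1 < y2 -> y2 < y3 ->
  interp k ka al be y1 = 0 -> interp k ka al be y2 = 0 ->
  interp k ka al be y3 = 0 ->
  0 <= ka -> be <= (k - 1) * (y1 * y2 * (y1 + y2)) ->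
  let bound y := (k - 1) * ((y - y1) * (y - y2) * (y + y1 + y2))
    * (1 - y `^ (2 * k) / y3 `^ (2 * k)) in
  (forall y, y1 < y < y2 -> interp k ka al be y <= - bound y) /\
  (forall y, y2 < y < y3 -> - interp k ka al be y <= bound y).
Proof.
move=> k1 y10 y12 y23 z1 z2 z3 ka0 be_le bound.
pose ee := y1 ^+ 2 + y1 * y2 + y2 ^+ 2; pose ff := y1 * y2 * (y1 + y2).
have y30 : 0 < y3 by lra.
pose P3 := y3 `^ (2 * k).
have P30 : 0 < P3 by exact: powR_gt0.
pose c := (k - 1) / P3.
have c0 : 0 <= c by rewrite divr_ge0 ?(ltW P30)//; lra.
pose a' := (k - 1) * ee - al; pose b' := be - (k - 1) * ff.
pose f u := ka * u `^ (2 * k + 1) - c * (u `^ (2 * k + 3) - ee * u `^ (2 * k + 1)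
  + ff * u `^ (2 * k)) - a' * u - b'.
pose f' u := ka * ((2 * k + 1) * u `^ (2 * k + 1 - 1))
  - c * ((2 * k + 3) * u `^ (2 * k + 3 - 1) - ee * ((2 * k + 1) * u `^ (2 * k + 1 - 1))
  + ff * (2 * k * u `^ (2 * k - 1))) - a'.
pose q u := (ka + c * ee) * (2 * k + 1) * (2 * k) * u
  - c * (2 * k + 3) * (2 * k + 2) * u ^+ 3 - c * ff * (2 * k) * (2 * k - 1).
pose f'' u := u `^ (2 * k - 2) * q u.
have fE y : 0 < y -> f y = interp k ka al be y + bound y.
  move=> y0; rewrite /f /interp /bound -/P3 /c /a' /b' /ee /ff.
  rewrite (@powR_shiftn R y (2 * k + 3) (2 * k) 3)//.
  rewrite (@powR_shiftn R y (2 * k + 1) (2 * k) 1)//.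
  by field; rewrite gt_eqF.
have fd x : 0 < x -> drv x f (f' x).
  by move=> x0; rewrite /f /f'; apply: drv_eq; [drv; exact: x0|cbv beta; ring].
have f'd x : 0 < x -> drv x f' (f'' x).
  move=> x0; rewrite /f' /f''; apply: drv_eq; first by drv; exact: x0.
  cbv beta.
  rewrite (@powR_shiftn R x (2 * k + 1 - 1 - 1) (2 * k - 2) 1)//; last by ring.
  rewrite (@powR_shiftn R x (2 * k + 3 - 1 - 1) (2 * k - 2) 3)//; last by ring.
  rewrite (@powR_shiftn R x (2 * k - 1 - 1) (2 * k - 2) 0)//; last by ring.
  by rewrite /q; ring.
(* The factor [q] is concave on the positive reals, so it cannot be negative between a nonnegative
   and a positive value; [concave] states the defect of concavity exactly. *)
have shape p0 p1 p2 : 0 < p0 -> p0 <= p1 -> p1 < p2 -> f'' p1 < 0 -> 0 < f'' p2 -> f'' p0 < 0.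
  move=> p00 p01 p12.
  have [p10 p20] : 0 < p1 /\ 0 < p2 by split; lra.
  have sg p : 0 < p -> 0 < p `^ (2 * k - 2) by exact: powR_gt0.
  rewrite /f'' !pmulr_rlt0 ?pmulr_rgt0 ?sg// => q1 q2.
  rewrite ltNge; apply/negP => q0.
  have [k3 k2] : 0 <= 2 * k + 3 /\ 0 <= 2 * k + 2 by split; lra.
  have C0 := mulr_ge0 (mulr_ge0 c0 k3) k2.
  have concave : q p1 * (p2 - p0) - q p0 * (p2 - p1) - q p2 * (p1 - p0)
     = c * (2 * k + 3) * (2 * k + 2) * ((p1 - p0) * (p2 - p1) * (p2 - p0) * (p0 + p1 + p2)).
    by rewrite /q; ring.
  have d1 : 0 <= (p1 - p0) * (p2 - p1) * (p2 - p0) * (p0 + p1 + p2).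
    by apply: mulr_ge0; [apply: mulr_ge0; [apply: mulr_ge0|]|]; lra.
  have t0 := mulr_ge0 C0 d1; rewrite -concave in t0.
  have t1 : q p1 * (p2 - p0) < 0 by rewrite pmulr_llt0 ?subr_gt0//; lra.
  have t2 : 0 <= q p0 * (p2 - p1) by apply: mulr_ge0 => //; lra.
  have t3 : 0 <= q p2 * (p1 - p0) by apply: mulr_ge0; [exact: ltW|lra].
  by lra.
have ff0 : 0 <= ff by apply: mulr_ge0; [apply: mulr_ge0|]; lra.
have ee0 : 0 <= ee.
  by apply: addr_ge0; [apply: addr_ge0; [exact: sqr_ge0|apply: mulr_ge0; lra]|exact: sqr_ge0].
have near0 u : 0 < u -> u <= 1 -> - ((c + c * ff + `|a'|) * u) <= f u.
  move=> u0 u1; have u01 : 0 < u <= 1 by rewrite u0.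
  have h1 : u `^ (2 * k + 3) <= u by apply: ge1r_powR => //; lra.
  have h2 : u `^ (2 * k) <= u by apply: ge1r_powR => //; lra.
  have h3 : 0 <= u `^ (2 * k + 1) by exact: powR_ge0.
  have h4 : a' * u <= `|a'| * u by rewrite ler_wpM2r ?ler_norm// ltW.
  have h5 : 0 <= - b' by rewrite oppr_ge0 /b' subr_le0.
  have g1 := ler_wpM2l c0 h1.
  have g2 := ler_wpM2l (mulr_ge0 c0 ff0) h2.
  have g3 := mulr_ge0 (mulr_ge0 c0 ee0) h3.
  have g4 := mulr_ge0 ka0 h3.
  rewrite /f; lra.
have y20 : 0 < y2 by lra.
have f1 : f y1 = 0 by rewrite fE// z1 /bound subrr !(mul0r, mulr0) addr0.
have f2 : f y2 = 0 by rewrite fE// z2 /bound subrr mulr0 !(mul0r, mulr0) addr0.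
have f3 : f y3 = 0 by rewrite fE// z3 /bound divff ?gt_eqF// subrr mulr0 addr0.
split=> y /andP[ya yb].
  have := three_zeros_le0 y10 y12 y23 fd f'd shape near0 f1 f2 f3 ya yb.
  by rewrite fE; lra.
have := three_zeros_ge0 y10 y12 y23 fd f'd shape near0 f1 f2 f3 ya yb.
by rewrite fE; lra.
Qed.

End InterpolationLine.

(** * Signs of the directional derivative *)

Section PairSign.
Variable R : realType.
Variables k a1 a2 a3 ka al be : R.
Local Notation E := (@expR R).
Local Notation th := (k + 1 / 2).
Implicit Types u v w d e m x : R.

Let r0 := E (- a1) + E (- a2) + E (- a3).
Let P := E (k * a1) + E (k * a2) + E (k * a3).
Let c1 := r0 - al / k.
Let c2 := be / th.

(* [d/dv - d/du] of the comparison function at the point with coordinates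
   [v, u, -(v + u)]. *)
Definition pair_gradient v u : R :=
  k * (E (k * v) - E (k * u)) * (E (- v) + E (- u) + E (v + u) - c1)
  + (E (- u) - E (- v)) * (E (k * v) + E (k * u) + E (- (k * (v + u))) - P)
  - (k - 1) * (E ((k - 1) * v) - E ((k - 1) * u))
  - c2 * th * (E (th * v) - E (th * u)).

Lemma pair_gradientE v u : pair_gradient v u =
  2 * E (k * ((v + u) / 2)) * phi k c1 c2 P ((v + u) / 2) ((v - u) / 2).
Proof.
set m := (v + u) / 2; set d := (v - u) / 2.
have -> : v = m + d by rewrite /m /d; field.
have -> : u = m - d by rewrite /m /d; field.
clearbody m d; rewrite /pair_gradient /phi.
(* Every exponential below is a monomial in these four quantities and their inverses, so the claim
   becomes a polynomial identity. *)
pose M := E (m / 2); pose M' := E (- (m / 2)).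
pose A := E (k * m); pose A' := E (- (k * m)).
pose D := E (d / 2); pose D' := E (- (d / 2)).
pose B := E (k * d); pose B' := E (- (k * d)).
have MM : M * M' = 1 by rewrite expRxMexpNx_1.
have AA : A * A' = 1 by rewrite expRxMexpNx_1.
have DD : D * D' = 1 by rewrite expRxMexpNx_1.
have BB : B * B' = 1 by rewrite expRxMexpNx_1.
have -> : E (k * (m + d)) = A * B by rewrite -expRD; congr expR; ring.
have -> : E (k * (m - d)) = A * B' by rewrite -expRD; congr expR; ring.
have -> : E (- (m + d)) = M' ^+ 2 * D' ^+ 2.
  by rewrite !expr2 -!expRD; congr expR; field.
have -> : E (- (m - d)) = M' ^+ 2 * D ^+ 2.
  by rewrite !expr2 -!expRD; congr expR; field.
have -> : E (m + d + (m - d)) = M ^+ 4.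
  by rewrite [M ^+ 4](exprM _ 2 2) !expr2 -!expRD; congr expR; field.
have -> : E (2 * m) = M ^+ 4.
  by rewrite [M ^+ 4](exprM _ 2 2) !expr2 -!expRD; congr expR; field.
have -> : E (- (k * (m + d + (m - d)))) = A' ^+ 2.
  by rewrite !expr2 -!expRD; congr expR; field.
have -> : E ((k - 1) * (m + d)) = A * B * M' ^+ 2 * D' ^+ 2.
  by rewrite !expr2 -!expRD; congr expR; field.
have -> : E ((k - 1) * (m - d)) = A * B' * M' ^+ 2 * D ^+ 2.
  by rewrite !expr2 -!expRD; congr expR; field.
have -> : E (th * (m + d)) = A * B * M * D by rewrite -!expRD; congr expR; field.
have -> : E (th * (m - d)) = A * B' * M * D' by rewrite -!expRD; congr expR; field.
have -> : E (- ((k + 1) * m)) = A' * M' ^+ 2 by rewrite !expr2 -!expRD; congr expR; field.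
have -> : E (- ((3 * k + 1) * m)) = A' ^+ 3 * M' ^+ 2.
  by rewrite exprS !expr2 -!expRD; congr expR; field.
have -> : E (- m) = M' ^+ 2 by rewrite !expr2 -!expRD; congr expR; field.
rewrite /sh.
have -> : E ((k + 1) * d) = B * D ^+ 2 by rewrite !expr2 -!expRD; congr expR; field.
have -> : E (- ((k + 1) * d)) = B' * D' ^+ 2.
  by rewrite !expr2 -!expRD; congr expR; field.
have -> : E (th * d) = B * D by rewrite -!expRD; congr expR; field.
have -> : E (- (th * d)) = B' * D' by rewrite -!expRD; congr expR; field.
have -> : E d = D ^+ 2 by rewrite !expr2 -!expRD; congr expR; field.
have -> : E (- d) = D' ^+ 2 by rewrite !expr2 -!expRD; congr expR; field.
rewrite -/A -/B -/B' -/M; clearbody A A' B B' M M' D D' c1 c2 P.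
by field: MM AA DD BB.
Qed.

Hypotheses (k_gt1 : 1 < k) (a12_lt : a2 < a1) (a23_lt : a3 < a2).
Hypothesis a_sum : a1 + a2 + a3 = 0.
Let y1 := E (- a1 / 2).
Let y2 := E (- a2 / 2).
Let y3 := E (- a3 / 2).
Hypothesis zero1 : interp k ka al be y1 = 0.
Hypothesis zero2 : interp k ka al be y2 = 0.
Hypothesis zero3 : interp k ka al be y3 = 0.
Hypothesis ka_ge0 : 0 <= ka.
Hypothesis be_le : be <= (k - 1) * (y1 * y2 * (y1 + y2)).

Let y10 : 0 < y1. Proof. exact: expR_gt0. Qed.
Let y12 : y1 < y2.
Proof. by have h := a12_lt; rewrite ltr_expR; lra. Qed.
Let y23 : y2 < y3.
Proof. by have h := a23_lt; rewrite ltr_expR; lra. Qed.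

Let c2th : c2 * th = be.
Proof. by have k1 := k_gt1; rewrite divfK// gt_eqF//; lra. Qed.

Let exp_half u : E (- u) = E (- u / 2) ^+ 2.
Proof. by rewrite expr2 -expRD; congr expR; field. Qed.

Let powE u : E (- u / 2) `^ (2 * k) = E (- (k * u)).
Proof. by rewrite -expRM; congr expR; field. Qed.

Let interpE u : E (th * u) * interp k ka al be (E (- u / 2)) =
  ka - ((k - 1) * E ((k - 1) * u) - al * E (k * u) + be * E (th * u)).
Proof.
rewrite /interp -expRM.
have e1 : E (th * u) * E (- u / 2 * (2 * k + 1)) = 1.
  by rewrite -expRD -[RHS]expR0; congr expR; field.
have e2 : E (th * u) * E (- u / 2) ^+ 3 = E ((k - 1) * u).
  by rewrite exprS expr2 -!expRD; congr expR; field.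
have e3 : E (th * u) * E (- u / 2) = E (k * u) by rewrite -!expRD; congr expR; field.
by rewrite -e2 -e3; ring: e1.
Qed.

(** The terms with [al] and [be] and those from [q_{k-1}] are expressed by [interp] at the two
    coordinates; [ka] cancels in the difference. *)
Lemma pair_gradient_interp v u : pair_gradient v u =
  k * (E (k * v) - E (k * u)) * (E (- v) + E (- u) + E (v + u) - r0)
  + (E (- u) - E (- v)) * (E (k * v) + E (k * u) + E (- (k * (v + u))) - P)
  + E (th * v) * interp k ka al be (E (- v / 2))
  - E (th * u) * interp k ka al be (E (- u / 2)).
Proof.
have k1 := k_gt1.
rewrite !interpE /pair_gradient c2th /c1.
by field; rewrite gt_eqF//; lra.
Qed.

Let interp_bound u : a3 <= u -> u <= a1 ->
  let y := E (- u / 2) in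
  let bound := (k - 1) * ((y - y1) * (y - y2) * (y + y1 + y2)) * (1 - E (k * (a3 - u))) in
  (u <= a2 -> - interp k ka al be y <= bound) /\
  (a2 <= u -> interp k ka al be y <= - bound).
Proof.
move=> a3u ua1 y bound.
have [lo hi] := interp_line k_gt1 y10 y12 y23 zero1 zero2 zero3 ka_ge0 be_le.
have q : E (k * (a3 - u)) = y `^ (2 * k) / y3 `^ (2 * k).
  by rewrite !powE -expRN -expRD; congr expR; ring.
have b0 : (u == a1) || (u == a2) || (u == a3) -> interp k ka al be y = 0 /\ bound = 0.
  rewrite /bound /y => /orP[/orP[]|] /eqP ->.
  - by rewrite -/y1 zero1 subrr !(mul0r, mulr0).
  - by rewrite -/y2 zero2 subrr !(mul0r, mulr0).
  - by rewrite -/y3 zero3 subrr !mulr0 expR0 subrr !mulr0.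
case: (boolP ((u == a1) || (u == a2) || (u == a3))) => [/b0[-> ->]|].
  by rewrite oppr0.
rewrite !negb_or => /andP[/andP[n1 n2] n3].
have ua1' : u < a1 by rewrite lt_neqAle n1.
have a3u' : a3 < u by rewrite lt_neqAle eq_sym n3.
split => u2.
  have u2' : u < a2 by rewrite lt_neqAle n2.
  have := hi y; rewrite -q; apply.
  by rewrite !ltr_expR; apply/andP; split; lra.
have u2' : a2 < u by rewrite lt_neqAle eq_sym n2.
have := lo y; rewrite -q; apply.
by rewrite !ltr_expR; apply/andP; split; lra.
Qed.

Lemma pair_gradient_gamma v u : (v == a1) && (u == a2) || (v == a2) && (u == a3) ->
  pair_gradient v u = 0.
Proof.
have s := a_sum; rewrite pair_gradient_interp /r0 /P.
case/orP => /andP[/eqP -> /eqP ->]; rewrite ?zero1 ?zero2 ?zero3.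
  have -> : a1 + a2 = - a3 by lra.
  by rewrite mulrN opprK; ring.
have -> : a2 + a3 = - a1 by lra.
by rewrite mulrN opprK; ring.
Qed.

(* Three of the four terms of [pair_gradient_interp] carry the factor
   [1 - e^{k (a3 - u)}]. *)
Lemma pair_gradient_bottom_le0 u : a2 <= u -> u <= a1 -> pair_gradient u a3 <= 0.
Proof.
have [k1 s h12 h23] := And4 k_gt1 a_sum a12_lt a23_lt; move=> a2u ua1.
have a3u : a3 <= u by lra.
have [_ /(_ a2u) hI] := interp_bound a3u ua1.
rewrite pair_gradient_interp zero3 mulr0 subr0.
set y := E (- u / 2) in hI *.
have y0 : 0 < y by exact: expR_gt0.
have y1y : y1 <= y by rewrite ler_expR; lra.
have yy2 : y <= y2 by rewrite ler_expR; lra.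
have [y1p y2p] := (expR_gt0 (- a1 / 2), expR_gt0 (- a2 / 2)).
rewrite -/y1 -/y2 in y1p y2p.
set w := 1 - E (k * (a3 - u)) in hI.
have w0 : 0 <= w by rewrite subr_ge0 -[leRHS]expR0 ler_expR; nra.
have ek : E (k * u) - E (k * a3) = E (k * u) * w.
  by rewrite /w mulrBr mulr1 -expRD; congr (_ - expR _); ring.
have er : E (- u) + E (- a3) + E (u + a3) - r0
    = - ((y ^+ 2 - y1 ^+ 2) * (y2 ^+ 2 - y ^+ 2) / y ^+ 2).
  have -> : E (u + a3) = (y1 * y2 / y) ^+ 2.
    rewrite /y1 /y2 /y -expRN -!expRD expr2 -expRD; congr expR; lra.
  by rewrite /r0 !exp_half -/y1 -/y2 -/y; field; rewrite gt_eqF.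
have ep : E (k * u) + E (k * a3) + E (- (k * (u + a3))) - P
    = - ((E (k * a1) - E (k * u)) * (E (k * u) - E (k * a2)) / E (k * u)).
  have -> : E (- (k * (u + a3))) = E (k * a1) * E (k * a2) / E (k * u).
    by rewrite -expRN -!expRD; congr expR; rewrite (_ : a3 = - a1 - a2); [ring|lra].
  by rewrite /P; field; rewrite gt_eqF// expR_gt0.
have eth : E (th * u) = E (k * u) / y.
  by rewrite /y -expRN -expRD; congr expR; field.
rewrite ek er ep eth.
have t2 : 0 <= (E (- a3) - E (- u)) * ((E (k * a1) - E (k * u)) *
    (E (k * u) - E (k * a2)) / E (k * u)).
  by apply: mulr_ge0; [|apply: divr_ge0; [apply: mulr_ge0|exact: expR_ge0]];
    rewrite subr_ge0 ler_expR; nra.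
have t1 : E (k * u) / y * interp k ka al be y <= E (k * u) / y *
    - ((k - 1) * ((y - y1) * (y - y2) * (y + y1 + y2)) * w).
  by rewrite ler_wpM2l// divr_ge0// ?expR_ge0 ?ltW.
have t3 : 0 <= E (k * u) * w * (y - y1) * (y2 - y) / y ^+ 2
    * (k * ((y + y1) * (y2 + y)) - (k - 1) * (y * (y + y1 + y2))).
  apply: mulr_ge0.
    by rewrite divr_ge0 ?sqr_ge0// !mulr_ge0 ?expR_ge0//; lra.
  have : 0 <= (k - 1) * (y1 * y2) by rewrite !mulr_ge0//; lra.
  have : 0 <= (y + y1) * (y2 + y) by rewrite mulr_ge0//; lra.
  lra.
have e3 : E (k * u) * w * (y - y1) * (y2 - y) / y ^+ 2
    * (k * ((y + y1) * (y2 + y)) - (k - 1) * (y * (y + y1 + y2)))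
  = k * (E (k * u) * w) * ((y ^+ 2 - y1 ^+ 2) * (y2 ^+ 2 - y ^+ 2) / y ^+ 2)
    + E (k * u) / y * ((k - 1) * ((y - y1) * (y - y2) * (y + y1 + y2)) * w).
  by field; rewrite gt_eqF.
by move: t1 t2 t3; rewrite e3; lra.
Qed.

(** The first term of [pair_gradient_interp] is nonpositive and is dropped. The second one,
    estimated by Bernoulli's inequality, outweighs the bound on the [interp] term. *)
Lemma pair_gradient_top_le0 u : a3 <= u -> u <= a2 -> pair_gradient a1 u <= 0.
Proof.
have [k1 s h12 h23] := And4 k_gt1 a_sum a12_lt a23_lt; move=> a3u ua2.
have ua1 : u <= a1 by lra.
have [/(_ ua2) hI _] := interp_bound a3u ua1.
rewrite pair_gradient_interp zero1 mulr0 addr0.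
set y := E (- u / 2) in hI *.
have y0 : 0 < y by exact: expR_gt0.
have y2y : y2 <= y by rewrite ler_expR; lra.
have yy3 : y <= y3 by rewrite ler_expR; lra.
have [y1p y2p] := (expR_gt0 (- a1 / 2), expR_gt0 (- a2 / 2)).
rewrite -/y1 -/y2 in y1p y2p; have h12' := y12.
set w := 1 - E (k * (a3 - u)) in hI.
have w0 : 0 <= w by rewrite subr_ge0 -[leRHS]expR0 ler_expR; nra.
have er : E (- a1) + E (- u) + E (a1 + u) - r0
    = - ((y ^+ 2 - y2 ^+ 2) * (y3 ^+ 2 - y ^+ 2) / y ^+ 2).
  have -> : E (a1 + u) = (y2 * y3 / y) ^+ 2.
    rewrite /y2 /y3 /y -expRN -!expRD expr2 -expRD; congr expR; lra.
  by rewrite /r0 !exp_half -/y2 -/y3 -/y; field; rewrite gt_eqF.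
have ep : E (k * a1) + E (k * u) + E (- (k * (a1 + u))) - P
    = - ((E (k * a2) - E (k * u)) * w).
  have -> : E (- (k * (a1 + u))) = E (k * a2) * E (k * (a3 - u)).
    by rewrite -!expRD; congr expR; rewrite (_ : a1 = - a2 - a3); [ring|lra].
  have -> : E (k * u) = E (k * a3) / E (k * (a3 - u)).
    by rewrite -expRN -!expRD; congr expR; ring.
  by rewrite /P /w; field; rewrite gt_eqF// expR_gt0.
have eth : E (th * u) = E (k * u) / y.
  by rewrite /y -expRN -expRD; congr expR; field.
(* Bernoulli's inequality for the power [2 k] of [y / y2], where [y / y2 = e^z]. *)
have bern : 2 * k * (y - y2) / y2 * E (k * u) <= E (k * a2) - E (k * u).
  pose z := (a2 - u) / 2; have z0 : 0 <= z by rewrite /z; lra.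
  have : 2 * k * (E z - 1) <= E (2 * k * z) - 1.
    rewrite -subr_ge0; have -> : 0 = E (2 * k * 0) - 1 - 2 * k * (E 0 - 1).
      by rewrite mulr0 expR0; ring.
    apply: (@drv_ge0_le R (fun t => E (2 * k * t) - 1 - 2 * k * (E t - 1))
      (fun t => 2 * k * (E (2 * k * t) - E t))); first exact: z0.
      by move=> t _; drvc; ring.
    move=> t /andP[t0 _]; rewrite mulr_ge0 ?subr_ge0 ?ler_expR; [by []|lra|nra].
  have -> : E z = y / y2.
    by rewrite /y /y2 -expRN -expRD; congr expR; rewrite /z; field.
  have -> : E (2 * k * z) = E (k * a2) / E (k * u).
    by rewrite -expRN -expRD; congr expR; rewrite /z; field.
  move/(ler_wpM2r (expR_ge0 (k * u))); rewrite !mulrBl divfK ?mul1r//; last first.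
    by rewrite gt_eqF// expR_gt0.
  have -> : 2 * k * (y - y2) / y2 = 2 * k * (y / y2 - 1) by field; rewrite gt_eqF.
  lra.
rewrite er ep eth -[E (- u)]/(E (- u)) !exp_half -/y -/y1.
have g1 : 0 <= k * (E (k * a1) - E (k * u))
    * ((y ^+ 2 - y2 ^+ 2) * (y3 ^+ 2 - y ^+ 2) / y ^+ 2).
  apply: mulr_ge0.
    by apply: mulr_ge0; [lra|rewrite subr_ge0 ler_expR; nra].
  rewrite divr_ge0 ?sqr_ge0// mulr_ge0// subr_ge0.
    by rewrite !expr2 ler_pM// ltW.
  by rewrite !expr2 ler_pM// ltW.
have g2 : (y ^+ 2 - y1 ^+ 2) * (2 * k * (y - y2) / y2 * E (k * u) * w) <=
    (y ^+ 2 - y1 ^+ 2) * ((E (k * a2) - E (k * u)) * w).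
  rewrite ler_wpM2l// ?subr_ge0 ?ler_wpM2r// !expr2 ler_pM//; lra.
have g3 : E (k * u) / y * - interp k ka al be y <= E (k * u) / y *
    ((k - 1) * ((y - y1) * (y - y2) * (y + y1 + y2)) * w).
  by rewrite ler_wpM2l// divr_ge0// ?expR_ge0 ?ltW.
have g4 : 0 <= E (k * u) * w * (y - y1) * (y - y2) / (y * y2)
    * (2 * k * ((y + y1) * y) - (k - 1) * (y2 * (y + y1 + y2))).
  apply: mulr_ge0.
    rewrite divr_ge0 ?mulr_ge0 ?expR_ge0//; lra.
  have q1 : y2 * (y + y1 + y2) <= y * (2 * (y + y1)) by rewrite ler_pM//; lra.
  have q2 : (k - 1) * (y2 * (y + y1 + y2)) <= (k - 1) * (y * (2 * (y + y1))).
    by rewrite ler_wpM2l//; lra.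
  have q3 : 0 <= y * (y + y1) by rewrite mulr_ge0//; lra.
  lra.
have e4 : E (k * u) * w * (y - y1) * (y - y2) / (y * y2)
    * (2 * k * ((y + y1) * y) - (k - 1) * (y2 * (y + y1 + y2)))
  = (y ^+ 2 - y1 ^+ 2) * (2 * k * (y - y2) / y2 * E (k * u) * w)
    - E (k * u) / y * ((k - 1) * ((y - y1) * (y - y2) * (y + y1 + y2)) * w).
  by field; rewrite !gt_eqF.
by move: g1 g2 g3 g4; rewrite e4; lra.
Qed.

Hypothesis be_th_le : be * th <= 2 * (k - 1) ^+ 2.
Hypothesis be_th_ge : 2 * (k - 1) ^+ 2 * y1 ^+ 3 <= be * th.

Let pg_phi v u : (0 <= pair_gradient v u <->
    0 <= phi k c1 c2 P ((v + u) / 2) ((v - u) / 2)) /\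
  (pair_gradient v u <= 0 <-> phi k c1 c2 P ((v + u) / 2) ((v - u) / 2) <= 0).
Proof.
have E0 : 0 < 2 * E (k * ((v + u) / 2)) by rewrite mulr_gt0// expR_gt0.
by rewrite pair_gradientE (pmulr_rge0 _ E0) (pmulr_rle0 _ E0).
Qed.

Let be_ge0 : 0 <= be.
Proof.
have k1 := k_gt1; have y0 := y10.
have th0 : 0 < th by lra.
rewrite -(pmulr_lge0 _ th0) (le_trans _ be_th_ge)//.
by apply: mulr_ge0; [rewrite mulr_ge0 ?sqr_ge0|rewrite exprn_ge0// ltW].
Qed.

Let be_exp : be <= 2 * (k - 1) * E ((a3 - a2) / 2).
Proof.
have [k1 s h12] := And3 k_gt1 a_sum a12_lt.
have e1 : y1 * y2 * y2 = E ((a3 - a2) / 2).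
  by rewrite /y1 /y2 -!expRD; congr expR; lra.
have e2 : y1 * y2 * y1 <= E ((a3 - a2) / 2) by rewrite /y1 /y2 -!expRD ler_expR; lra.
have : (k - 1) * (y1 * y2 * y1) <= (k - 1) * E ((a3 - a2) / 2) by rewrite ler_wpM2l//; lra.
by have := be_le; rewrite -e1; lra.
Qed.

Let be_ch : be <= (k - 1) * (E (3 / 4 * a3) * (E ((a1 - a2) / 4) + E (- ((a1 - a2) / 4)))).
Proof.
have s := a_sum.
have e1 : y1 * y2 * y1 = E (3 / 4 * a3) * E (- ((a1 - a2) / 4)).
  by rewrite /y1 /y2 -!expRD; congr expR; lra.
have e2 : y1 * y2 * y2 = E (3 / 4 * a3) * E ((a1 - a2) / 4).
  by rewrite /y1 /y2 -!expRD; congr expR; lra.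
by rewrite [E (3 / 4 * a3) * _]mulrDr -e1 -e2 [_ + y1 * y2 * y1]addrC -mulrDr.
Qed.

Let Pexp w : w <= a1 -> E (k * w) <= P.
Proof.
have k1 := k_gt1; move=> wa.
have : E (k * w) <= E (k * a1) by rewrite ler_expR; nra.
by rewrite /P; have := expR_gt0 (k * a2); have := expR_gt0 (k * a3); lra.
Qed.

Let phi_transfer (m d e : R) : 0 < d -> d <= e ->
  phi k c1 c2 P m d * sh (k * e) <= phi k c1 c2 P m e * sh (k * d) ->
  (0 <= phi k c1 c2 P m d -> 0 <= phi k c1 c2 P m e) /\
  (phi k c1 c2 P m e <= 0 -> phi k c1 c2 P m d <= 0).
Proof.
have k1 := k_gt1; move=> d0 de.
have kd : 0 < sh (k * d) by apply: sh_gt0; apply: mulr_gt0; lra.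
have ke : 0 < sh (k * e) by apply: sh_gt0; apply: mulr_gt0; lra.
move=> h; split => p.
  by rewrite -(pmulr_lge0 _ kd) (le_trans _ h)// mulr_ge0// ltW.
by rewrite -(pmulr_lle0 _ ke) (le_trans h)// mulr_le0_ge0// ltW.
Qed.

Let pair_gradient_diag v : pair_gradient v v = 0.
Proof. by rewrite /pair_gradient; ring. Qed.

(** All three coordinates lie between [a3] and [a1]. At fixed sum [v + u] the gap is widened until
    [v' = a1] or [u' = a3], where the two preceding lemmas give the sign; [phi_ratio_ch] brings it
    back to the smaller gap. *)
Lemma pair_gradient_le0 v u : u <= v -> v <= a1 -> a3 <= u ->
  a3 <= - (v + u) -> - (v + u) <= a1 -> pair_gradient v u <= 0.
Proof.
have [k1 s h12 h23] := And4 k_gt1 a_sum a12_lt a23_lt.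
rewrite le_eqVlt => /predU1P[->|uv] va1 a3u w3 w1; first by rewrite pair_gradient_diag.
suff [v' [u' [sum gap neg]]] : exists v' u', [/\ v' + u' = v + u, v - u <= v' - u' /\
    3 * a3 + 3 * (v + u) + a1 - a2 <= v' - u' & pair_gradient v' u' <= 0].
  case: gap => gap gap'; have {}neg := proj1 (proj2 (pg_phi v' u')) neg.
  rewrite sum in neg; apply: (proj2 (proj2 (pg_phi v u))).
  have d0 : 0 < (v - u) / 2 by lra.
  have de : (v - u) / 2 <= (v' - u') / 2 by lra.
  have PE : E (- (2 * k * ((v + u) / 2))) <= P.
    rewrite (_ : - (2 * k * ((v + u) / 2)) = k * (- (v + u))); last by field.
    exact: Pexp.
  have cE : c2 * th * E (3 / 2 * ((v + u) / 2)) <=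
      (k + 1) * (E ((v' - u') / 2 / 2) + E (- ((v' - u') / 2 / 2))); last first.
    exact: (proj2 (phi_transfer d0 de (phi_ratio_ch c1 k_gt1 d0 de PE cE)) neg).
  rewrite c2th.
  set t := (v' - u') / 2 / 2; set z := (a1 - a2) / 4.
  have [z0 t0] : 0 <= z /\ 0 <= t by rewrite /z /t; split; lra.
  (* If [z <= t], monotonicity of the hyperbolic cosine suffices, as [a3 + v + u <= 0]. Otherwise
     passing from [z] to [t] costs a factor [e^(z - t)], and the second gap bound keeps the total
     exponent nonpositive. *)
  have h : E (3 / 4 * a3) * (E z + E (- z)) * E (3 / 2 * ((v + u) / 2)) <= E t + E (- t).
    rewrite mulrAC -expRD.
    have [zt|tz] := leP z t.
      have c := ch_le z0 zt.
      rewrite (le_trans _ c)// ler_piMl ?addr_ge0 ?expR_ge0//.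
      by rewrite -[leRHS]expR0 ler_expR; lra.
    have c : E z + E (- z) <= E (z - t) * (E t + E (- t)).
      rewrite mulrDr -!expRD subrK lerD2l ler_expR; lra.
    rewrite (le_trans (ler_wpM2l (expR_ge0 _) c))// mulrA -expRD.
    rewrite ler_piMl ?addr_ge0 ?expR_ge0// -[leRHS]expR0 ler_expR.
    by rewrite /z /t; lra.
  have := ler_wpM2r (expR_ge0 (3 / 2 * ((v + u) / 2))) be_ch.
  rewrite -/z => h'; rewrite (le_trans h')// -[leLHS]mulrA.
  have k10 : 0 <= k - 1 by lra.
  rewrite (le_trans (ler_wpM2l k10 h))// ler_wpM2r//; last by lra.
  by rewrite addr_ge0 ?expR_ge0.
have [w2|w2] := leP (- (v + u)) a2.
  exists a1, (v + u - a1); split; [by ring|split; lra|].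
  by apply: pair_gradient_top_le0; lra.
exists (v + u - a3), a3; split; [by ring|split; lra|].
by apply: pair_gradient_bottom_le0; lra.
Qed.

Let P_ge3 : 3 <= P.
Proof.
have s := a_sum.
have := expR_ge1Dx (k * a1); have := expR_ge1Dx (k * a2).
have := expR_ge1Dx (k * a3).
have : k * a1 + k * a2 + k * a3 = 0 by rewrite -!mulrDr s mulr0.
by rewrite /P; lra.
Qed.

Let c2_ge0 : 0 <= c2.
Proof. by have k1 := k_gt1; have b0 := be_ge0; rewrite divr_ge0//; lra. Qed.

Let c2_le : c2 * th ^+ 2 <= 2 * (k - 1) ^+ 2.
Proof. by rewrite expr2 mulrA c2th. Qed.

(** The ray consists of the points [(a1 + 2 t, a2 - t, a3 - t)]. Its top pair has mean
    [(a1 + a2 + t) / 2] and half-gap [(a1 - a2 + 3 t) / 2]; here the mean is kept and the half-gap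
    grows. *)
Let ray_transfer t (d e : R) : 0 <= t -> 0 < d -> d <= e ->
  (k - 1) * E ((a3 - a2) / 2 + 3 / 4 * (a1 + a2 + t)) <= (k + 1) * E (d / 2) ->
  0 <= phi k c1 c2 P ((a1 + a2 + t) / 2) d ->
  0 <= phi k c1 c2 P ((a1 + a2 + t) / 2) e.
Proof.
have [k1 s h12 h23] := And4 k_gt1 a_sum a12_lt a23_lt.
move=> t0 d0 de hE.
have PE : E (- (2 * k * ((a1 + a2 + t) / 2))) <= P.
  rewrite (_ : - (2 * k * ((a1 + a2 + t) / 2)) = k * (- (a1 + a2 + t))); last by field.
  by apply: Pexp; lra.
have cE : c2 * th * E (3 / 2 * ((a1 + a2 + t) / 2)) <= 2 * (k + 1) * E (d / 2).
  rewrite c2th.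
  have := ler_wpM2r (expR_ge0 (3 / 2 * ((a1 + a2 + t) / 2))) be_exp.
  rewrite -[X in _ <= X -> _]mulrA -expRD.
  rewrite (_ : (a3 - a2) / 2 + 3 / 2 * ((a1 + a2 + t) / 2) =
    (a3 - a2) / 2 + 3 / 4 * (a1 + a2 + t)); last by field.
  by move=> h; rewrite (le_trans h)//; lra.
exact: (proj1 (phi_transfer d0 de (phi_ratio_exp c1 k_gt1 d0 de PE cE))).
Qed.

(** From [s] to [t] the mean is raised first, with the gap fixed, and then the gap is widened, with
    the mean fixed. Steps of length at most [1 / k] keep [(k - 1) e^(3 (t - s) / 4) <= k + 1], as
    [ray_transfer] demands; iterating them from [gamma] covers the ray. *)
Let ray_step s t : 0 <= s -> s <= t -> t <= s + 1 / k ->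
  0 <= phi k c1 c2 P ((a1 + a2 + s) / 2) ((a1 - a2 + 3 * s) / 2) ->
  0 <= phi k c1 c2 P ((a1 + a2 + t) / 2) ((a1 - a2 + 3 * t) / 2).
Proof.
have [k1 sm h12 h23] := And4 k_gt1 a_sum a12_lt a23_lt.
move=> s0 st ts hs.
have t0 : 0 <= t by lra.
have d0 : 0 < (a1 - a2 + 3 * s) / 2 by lra.
have de : (a1 - a2 + 3 * s) / 2 <= (a1 - a2 + 3 * t) / 2 by lra.
apply: (ray_transfer t0 d0 de); last first.
  apply: le_trans hs _.
  by apply: (phi_mean_nondecreasing c1 k_gt1 P_ge3 c2_ge0 c2_le); lra.
have k0 : 0 < k by lra.
have ts' : t - s <= 1 / k by lra.
have x1 : 3 / 4 * (t - s) <= 3 / 4 / k by lra.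
have key : (k - 1) * E (3 / 4 * (t - s)) <= k + 1.
  pose x := 3 / 4 * (t - s).
  have e1 := expR_ge1Dx (- x).
  have e2 : E x * E (- x) = 1 by rewrite expRxMexpNx_1.
  have e3 := expR_gt0 x.
  have e4 : (k - 1) <= (k + 1) * E (- x).
    apply: (@le_trans _ _ ((k + 1) * (1 - 3 / 4 / k))); last first.
      by rewrite ler_wpM2l//; [lra|rewrite -/x in x1; lra].
    have : (k + 1) * (3 / 4 / k) <= 2 by rewrite mulrA ler_pdivrMr//; lra.
    lra.
  have := ler_wpM2r (ltW e3) e4.
  by rewrite -[X in _ <= X]mulrA [E (- x) * E x]mulrC e2 mulr1.
have -> : (a3 - a2) / 2 + 3 / 4 * (a1 + a2 + t)
   = 3 / 4 * (t - s) + (a1 - a2 + 3 * s) / 2 / 2 by lra.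
by rewrite expRD mulrA ler_wpM2r// expR_ge0.
Qed.

Let ray_phi s : 0 <= s ->
  0 <= phi k c1 c2 P ((a1 + a2 + s) / 2) ((a1 - a2 + 3 * s) / 2).
Proof.
have k1 := k_gt1; have k0 : 0 < k by lra.
have base : 0 <= phi k c1 c2 P ((a1 + a2 + 0) / 2) ((a1 - a2 + 3 * 0) / 2).
  rewrite mulr0 !addr0; apply: (proj1 (proj1 (pg_phi a1 a2))).
  by rewrite pair_gradient_gamma// !eqxx.
have rec (n : nat) : forall s, 0 <= s -> s <= n%:R / k ->
    0 <= phi k c1 c2 P ((a1 + a2 + s) / 2) ((a1 - a2 + 3 * s) / 2).
  elim: n => [|n IHn] t t0 tn.
    have -> : t = 0 by apply/eqP; rewrite eq_le t0 andbT (le_trans tn)// mul0r.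
    exact: base.
  have e : n.+1%:R / k = n%:R / k + 1 / k by rewrite -natr1 mulrDl.
  have [tk|tk] := leP t (1 / k).
    by apply: (@ray_step 0 t _ _ _ base); lra.
  have k'0 : 0 < 1 / k by rewrite divr_gt0.
  by apply: (@ray_step (t - 1 / k) t); [lra|lra|lra|apply: IHn; lra].
move=> s0; apply: (rec (Num.bound (s * k))) => //.
have sk : 0 <= s * k by rewrite mulr_ge0//; lra.
by rewrite ler_pdivlMr// ltW// archi_boundP.
Qed.

(** The second hypothesis says that the gap is at least that of the ray point with the same sum
    [v + u]. *)
Lemma pair_gradient_ray_ge0 v u : a1 + a2 <= v + u -> u + (v + u) <= a2 - a3 ->
  0 <= pair_gradient v u.
Proof.
have [k1 sm h12 h23] := And4 k_gt1 a_sum a12_lt a23_lt.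
move=> vu uu; pose t := v + u - a1 - a2.
have t0 : 0 <= t by rewrite /t; lra.
apply: (proj2 (proj1 (pg_phi v u))).
have -> : (v + u) / 2 = (a1 + a2 + t) / 2 by rewrite /t; field.
have d0 : 0 < (a1 - a2 + 3 * t) / 2 by lra.
have de : (a1 - a2 + 3 * t) / 2 <= (v - u) / 2 by rewrite /t; lra.
apply: (ray_transfer t0 d0 de); last exact: ray_phi.
have -> : (a3 - a2) / 2 + 3 / 4 * (a1 + a2 + t) = (a1 - a2 + 3 * t) / 2 / 2 by lra.
by rewrite ler_wpM2r ?expR_ge0//; lra.
Qed.

(** Starting from the zero at the pair [(a2, a3)], the gap is widened at third coordinate [a1], and
    then the third coordinate is raised to [- (v + u)]. *)
Lemma pair_gradient_third_ge0 v u : a1 <= - (v + u) -> a2 - a3 <= v - u ->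
  0 <= pair_gradient v u.
Proof.
have [k1 sm h12 h23] := And4 k_gt1 a_sum a12_lt a23_lt.
move=> w1 gap.
apply: (proj2 (proj1 (pg_phi v u))).
have d0 : 0 < (a2 - a3) / 2 by lra.
have de : (a2 - a3) / 2 <= (v - u) / 2 by lra.
have base : 0 <= phi k c1 c2 P (- a1 / 2) ((a2 - a3) / 2).
  have -> : - a1 / 2 = (a2 + a3) / 2 by lra.
  apply: (proj1 (proj1 (pg_phi a2 a3))).
  by rewrite pair_gradient_gamma// !eqxx orbT.
have PE : E (- (2 * k * (- a1 / 2))) <= P.
  by rewrite (_ : - (2 * k * (- a1 / 2)) = k * a1); [exact: Pexp|field].
have be2 : be <= 2 * (k - 1).
  have := be_exp; have : E ((a3 - a2) / 2) <= 1 by rewrite -[leRHS]expR0 ler_expR; lra.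
  move=> /(ler_wpM2l (_ : 0 <= 2 * (k - 1))) h; have /h : 0 <= 2 * (k - 1) by lra.
  lra.
have cE : c2 * th * E (3 / 2 * (- a1 / 2)) <=
    (k + 1) * (E ((v - u) / 2 / 2) + E (- ((v - u) / 2 / 2))).
  rewrite c2th; have e1 : E (3 / 2 * (- a1 / 2)) <= 1.
    by rewrite -[leRHS]expR0 ler_expR; lra.
  have ch : 2 <= E ((v - u) / 2 / 2) + E (- ((v - u) / 2 / 2)) by apply: ch_ge2; lra.
  have h1 := ler_wpM2l be_ge0 e1.
  have h2 : (k + 1) * 2 <= (k + 1) * (E ((v - u) / 2 / 2) + E (- ((v - u) / 2 / 2))).
    by rewrite ler_wpM2l//; lra.
  lra.
have {}base := proj1 (phi_transfer d0 de (phi_ratio_ch c1 k_gt1 d0 de PE cE)) base.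
rewrite (_ : (v + u) / 2 = - (- (v + u)) / 2); last by rewrite opprK.
apply: le_trans base _.
have a10 : 0 <= a1 by lra.
apply: (phi_third_nondecreasing c1 k_gt1 a10 w1); first by lra.
- have : E (k * a2) <= E (k * a1) by rewrite ler_expR; nra.
  have : E (k * a3) <= E (- (k * a1 / 2)) by rewrite ler_expR; nra.
  by rewrite /P; lra.
- have := be_th_ge; have -> : be * th = c2 * th ^+ 2 by rewrite expr2 mulrA c2th.
  have -> : y1 ^+ 3 = E (- (3 / 2 * a1)).
    by rewrite /y1 exprS expr2 -!expRD; congr expR; field.
  by [].
Qed.

End PairSign.

(** * The comparison inequality *)

Section Gap.
Variable R : realType.
Implicit Types (k s t x h : R).
Local Notation E := (@expR R).

(* The exponents, of sum zero, are [x, h - x, - h]. *)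
Definition psum s x h : R := E (s * x) + E (s * (h - x)) + E (s * - h).

(** This is [K], the sum of [e^(k eta_i - eta_j)] over ordered pairs of distinct indices. *)
Definition osum k x h : R :=
  psum k x h * psum (- 1) x h - psum (k - 1) x h.

Lemma comparison_path k xg hg al be x0 h0 a b t :
  let pg := pair_gradient k xg (hg - xg) (- hg) al be in
  let c1 := psum (- 1) xg hg - al / k in
  let c2 := be / (k + 1 / 2) in
  let x := x0 + a * t in let h := h0 + b * t in
  drv t (fun t => osum k (x0 + a * t) (h0 + b * t)
    - psum k xg hg * psum (- 1) (x0 + a * t) (h0 + b * t)
    - c1 * psum k (x0 + a * t) (h0 + b * t)
    - c2 * psum (k + 1 / 2) (x0 + a * t) (h0 + b * t))
  (a * pg x (h - x) + b * pg (h - x) (- h)).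
Proof.
move=> pg c1 c2 x h; rewrite /osum /psum; drvc.
rewrite -/x -/h /pg /pair_gradient.
have -> : x + (h - x) = h by ring.
have -> : h - x + - h = - x by ring.
have c1E : E (- xg) + E (- (hg - xg)) + E hg - al / k = c1.
  by rewrite /c1 /psum !mulN1r opprK.
rewrite !mulN1r !opprK c1E -/c2 !mulrN opprK.
clearbody x h c1 c2.
ring.
Qed.

(** This is the minimality of [G] at [gamma], for [gamma] with distinct coordinates. The bounds
    [c1 <= psum (- 1) xg hg] and [c2 <= 2] serve the later limit argument. *)
Lemma gap_bound k xg hg : 1 < k -> hg < 2 * xg -> xg < 2 * hg ->
  exists c1 c2 : R, [/\ 0 <= c1, c1 <= psum (- 1) xg hg, 0 <= c2, c2 <= 2 &
    forall x h, h <= 2 * x -> x <= 2 * h ->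
      (xg <= x /\ hg <= h) \/ (x <= xg /\ h <= hg) ->
    osum k xg hg + psum k xg hg * (psum (- 1) x h - psum (- 1) xg hg)
      + c1 * (psum k x h - psum k xg hg)
      + c2 * (psum (k + 1 / 2) x h - psum (k + 1 / 2) xg hg) <= osum k x h].
Proof.
move=> k1 g1 g2.
have a12 : hg - xg < xg by lra.
have a23 : - hg < hg - xg by lra.
have asum : xg + (hg - xg) + - hg = 0 by ring.
pose y1 := E (- xg / 2); pose y2 := E (- (hg - xg) / 2); pose y3 := E (- (- hg) / 2).
have y10 : 0 < y1 by exact: expR_gt0.
have y20 : 0 < y2 by exact: expR_gt0.
have y12 : y1 < y2 by rewrite ltr_expR; lra.
have y23 : y2 < y3 by rewrite ltr_expR; lra.
have y123 : y1 * y2 * y3 = 1.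
  by rewrite -!expRD -[RHS]expR0; congr expR; lra.
have [ka [al [be [z1 z2 z3 [ka0 be_le be_th_le al_le]]]]] :=
  interp_exists k1 y10 y12 y23 y123.
have [e1 [e2 [/andP[u1 _] /andP[u2 _] alE beE]]] := interp_cubic k1 y10 y12 y23 z1 z2 z3.
(* Both zeros of the cubic from [interp_cubic] are larger than [y1], which bounds [be] below. *)
have be_th_ge : 2 * (k - 1) ^+ 2 * y1 ^+ 3 <= be * (k + 1 / 2).
  rewrite beE (_ : 2 * (k - 1) ^+ 2 * y1 ^+ 3 = (k - 1) ^+ 2 * (2 * y1 ^+ 3)); last by ring.
  rewrite ler_wpM2l ?sqr_ge0//.
  have h1 : y1 * y1 <= e1 * e2 by rewrite ler_pM//; lra.
  have h2 : y1 + y1 <= e1 + e2 by lra.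
  have : y1 * y1 * (y1 + y1) <= e1 * e2 * (e1 + e2).
    by rewrite ler_pM ?mulr_ge0//; lra.
  by rewrite !exprS expr0; lra.
have al0 : 0 <= al.
  have k0 : 0 < k by lra.
  rewrite -(pmulr_lge0 _ k0) alE mulr_ge0 ?sqr_ge0//.
  by rewrite !addr_ge0 ?sqr_ge0// mulr_ge0//; lra.
have th0 : 0 < k + 1 / 2 by lra.
pose c1 := psum (- 1) xg hg - al / k; pose c2 := be / (k + 1 / 2).
pose pg := pair_gradient k xg (hg - xg) (- hg) al be.
have yr : y1 ^+ 2 + y2 ^+ 2 + y3 ^+ 2 = psum (- 1) xg hg.
  by rewrite /psum !expr2 -!expRD; congr (E _ + E _ + E _); field.
pose G x h := osum k x h - psum k xg hg * psum (- 1) x h - c1 * psum k x h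
  - c2 * psum (k + 1 / 2) x h.
have path x0 h0 a b (s : R) : 0 <= s ->
    (forall t, 0 <= t <= s ->
      0 <= a * pg (x0 + a * t) (h0 + b * t - (x0 + a * t))
           + b * pg (h0 + b * t - (x0 + a * t)) (- (h0 + b * t))) ->
    G x0 h0 <= G (x0 + a * s) (h0 + b * s).
  move=> s0 hp.
  have -> : G x0 h0 = G (x0 + a * 0) (h0 + b * 0) by rewrite !mulr0 !addr0.
  apply: (@drv_ge0_le R (fun t => G (x0 + a * t) (h0 + b * t)) _ _ _ s0 _ hp).
  by move=> t _; exact: comparison_path.
have k0 : 0 < k by lra.
have alk : al / k <= psum (- 1) xg hg by rewrite -yr (ler_pdivrMr _ _ k0) mulrC.
have alk0 : 0 <= al / k by apply: divr_ge0 => //; exact: ltW.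
exists c1, c2; split.
- by rewrite /c1; lra.
- by rewrite /c1; lra.
- have b0 : 0 <= be * (k + 1 / 2).
    rewrite (le_trans _ be_th_ge)// mulr_ge0 ?exprn_ge0 ?mulr_ge0 ?sqr_ge0//; lra.
  by rewrite divr_ge0 ?(ltW th0)// -(pmulr_lge0 _ th0).
- rewrite ler_pdivrMr// -(ler_pM2r th0) (le_trans be_th_le)// -[leRHS]mulrA.
  by rewrite ler_wpM2l// -expr2 ler_pXn2r// ?nnegrE; lra.
move=> x h c1x c2x cmp.
suff : G xg hg <= G x h by rewrite /G; lra.
have down v u : u <= v -> v <= xg -> - hg <= u -> - hg <= - (v + u) ->
    - (v + u) <= xg -> pg v u <= 0.
  exact: (pair_gradient_le0 k1 a12 a23 asum z1 z2 z3 ka0 be_le).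
have ray v u : xg + (hg - xg) <= v + u -> u + (v + u) <= hg - xg - - hg -> 0 <= pg v u.
  exact: (pair_gradient_ray_ge0 k1 a12 a23 asum z1 z2 z3 be_le be_th_le be_th_ge).
have third v u : xg <= - (v + u) -> hg - xg - - hg <= v - u -> 0 <= pg v u.
  exact: (pair_gradient_third_ge0 k1 a12 a23 asum z1 z2 z3 be_le be_th_ge).
case: cmp => -[cx ch].
  (* The path upwards follows the ray direction [(2, 1)] until [x] or [h] reaches its target, then
     changes only the other coordinate. *)
  pose s := Num.min ((x - xg) / 2) (h - hg).
  have s0 : 0 <= s by rewrite le_min; apply/andP; split; lra.
  apply: (@le_trans _ _ (G (xg + 2 * s) (hg + 1 * s))).
    apply: path => // t /andP[t0 _].
    apply: addr_ge0; apply: mulr_ge0 => //.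
      by apply: ray; lra.
    by apply: third; lra.
  have [hs|hs] := leP ((x - xg) / 2) (h - hg).
    have sE : s = (x - xg) / 2 by rewrite /s min_l.
    have ex : xg + 2 * s + 0 * (h - (hg + 1 * s)) = x by rewrite sE; field.
    have eh : hg + 1 * s + 1 * (h - (hg + 1 * s)) = h by ring.
    have := path (xg + 2 * s) (hg + 1 * s) 0 1 (h - (hg + 1 * s)).
    rewrite ex eh; apply; first by rewrite sE; lra.
    move=> t /andP[t0 _]; apply: addr_ge0; first by rewrite [0 * pg _ _]mul0r.
    by apply: mulr_ge0 => //; apply: third; lra.
  have sE : s = h - hg by rewrite /s min_r// ltW.
  have ex : xg + 2 * s + 1 * (x - (xg + 2 * s)) = x by ring.
  have eh : hg + 1 * s + 0 * (x - (xg + 2 * s)) = h by rewrite sE; ring.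
  have := path (xg + 2 * s) (hg + 1 * s) 1 0 (x - (xg + 2 * s)).
  rewrite ex eh; apply; first by rewrite sE; lra.
  move=> t /andP[t0 _]; apply: addr_ge0; last by rewrite [0 * pg _ _]mul0r.
  by apply: mulr_ge0 => //; apply: ray; lra.
(* Downwards the straight segment works: its points keep their coordinates ordered and between those
   of [gamma], so both pair gradients are nonpositive there. *)
have := path xg hg (x - xg) (h - hg) 1 ler01.
rewrite !mulr1 ![xg + _]addrC ![hg + _]addrC !subrK; apply => t /andP[t0 t1].
have t1' : 0 <= 1 - t by lra.
have xn : x - xg <= 0 by lra.
have hn : h - hg <= 0 by lra.
have p1 := mulr_ge0 t1' (_ : 0 <= 2 * xg - hg).
have p2 := mulr_ge0 t1' (_ : 0 <= 2 * hg - xg).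
have p3 := mulr_ge0 t0 (_ : 0 <= 2 * x - h).
have p4 := mulr_ge0 t0 (_ : 0 <= 2 * h - x).
have {}p1 : 0 <= (1 - t) * (2 * xg - hg) by apply: p1; lra.
have {}p2 : 0 <= (1 - t) * (2 * hg - xg) by apply: p2; lra.
have {}p3 : 0 <= t * (2 * x - h) by apply: p3; lra.
have {}p4 : 0 <= t * (2 * h - x) by apply: p4; lra.
have q1 := mulr_le0_ge0 xn t0; have q2 := mulr_le0_ge0 hn t0.
by apply: addr_ge0; apply: mulr_le0 => //; apply: down; lra.
Qed.

End Gap.

(** * Real exponents: boundary cases, scaling and inversion *)

Section RealExponents.
Variable R : realType.
Implicit Types (k s t x h : R).
Local Notation E := (@expR R).

Lemma psum_ge0 s x h : 0 <= psum s x h.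
Proof. by rewrite /psum !addr_ge0 ?expR_ge0. Qed.

(** Karamata's inequality for [u -> e^(s u)], by tangents at the smaller triple and summation by
    parts. *)
Lemma psum_le s x h x' h' : h <= 2 * x -> x <= 2 * h -> x <= x' -> h <= h' ->
  psum s x h <= psum s x' h'.
Proof.
move=> c1 c2 xx hh.
have tangent u v : E u + E u * (v - u) <= E v.
  have := ler_wpM2l (expR_ge0 u) (expR_ge1Dx (v - u)).
  by rewrite -expRD (addrC u) subrK mulrDr mulr1.
have mono a b : b <= a -> 0 <= s * (E (s * a) - E (s * b)).
  move=> ba; have [s0|s0] := leP 0 s.
    by rewrite mulr_ge0// subr_ge0 ler_expR ler_wpM2l.
  by apply: mulr_le0; [exact: ltW|rewrite subr_le0 ler_expR ler_wnM2l// ltW].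
have m1 : 0 <= s * (E (s * x) - E (s * (h - x))) by apply: mono; lra.
have m2 : 0 <= s * (E (s * (h - x)) - E (s * - h)) by apply: mono; lra.
have x0 : 0 <= x' - x by lra.
have h0 : 0 <= h' - h by lra.
have := mulr_ge0 m1 x0; have := mulr_ge0 m2 h0.
have := tangent (s * x) (s * x'); have := tangent (s * (h - x)) (s * (h' - x')).
have := tangent (s * - h) (s * - h').
rewrite /psum; lra.
Qed.

Lemma limit_ge0 (f : R -> R) d e0 : drv 0 f d -> 0 < e0 ->
  (forall e, 0 < e -> e < e0 -> 0 <= f e) -> 0 <= f 0.
Proof.
move=> [fd _] e00 fp; rewrite leNgt; apply/negP => f0.
have fc : {for 0, continuous f}.
  by apply: differentiable_continuous; exact/derivable1_diffP.
have : \forall x \near (0 : R), f x < 0 by apply: (cvgr_lt _ fc).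
case/nbhs_ballP => r /= r0 rb.
pose e := Num.min (r / 2) (e0 / 2).
have e0' : 0 < e by rewrite lt_min !divr_gt0.
have er : e <= r / 2 by rewrite ge_min lexx.
have ee : e <= e0 / 2 by rewrite ge_min lexx orbT.
have : f e < 0.
  apply: rb; rewrite /ball /= sub0r normrN gtr0_norm//; lra.
by rewrite ltNge fp//; lra.
Qed.

Lemma osum_interior k xl hl xg hg xm hm : 1 < k ->
  hl <= 2 * xl -> xl <= 2 * hl -> hm <= 2 * xm -> xm <= 2 * hm ->
  hg < 2 * xg -> xg < 2 * hg ->
  xg <= xl -> hg <= hl -> xm <= xg -> hm <= hg ->
  exists c1 c2 : R, [/\ 0 <= c1, c1 <= psum (- 1) xg hg, 0 <= c2, c2 <= 2 &
    psum k xg hg * (psum (- 1) xl hl + psum (- 1) xm hm - 2 * psum (- 1) xg hg)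
    + c1 * (psum k xl hl + psum k xm hm - 2 * psum k xg hg)
    + c2 * (psum (k + 1 / 2) xl hl + psum (k + 1 / 2) xm hm
            - 2 * psum (k + 1 / 2) xg hg)
    <= osum k xl hl + osum k xm hm - 2 * osum k xg hg].
Proof.
move=> k1 l1 l2 m1 m2 g1 g2 xgl hgl xmg hmg.
have [c1 [c2 [c10 c1r c20 c22 b]]] := gap_bound k1 g1 g2.
exists c1, c2; split => //.
have := b _ _ l1 l2 (or_introl (conj xgl hgl)).
have := b _ _ m1 m2 (or_intror (conj xmg hmg)).
lra.
Qed.

(* [osum_interior] at the perturbed point [(xg + a e, hg + b e)]: the hypothesis
   holds there up to the bracket of [F], which vanishes as [e] tends to 0. *)
Lemma osum_limit k xl hl xg hg xm hm a b e0 : 1 < k ->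
  hl <= 2 * xl -> xl <= 2 * hl -> hm <= 2 * xm -> xm <= 2 * hm ->
  hg <= 2 * xg -> xg <= 2 * hg ->
  0 <= a -> 0 <= b -> 0 < e0 ->
  (forall e, 0 < e -> e < e0 -> [/\ hg + b * e < 2 * (xg + a * e),
     xg + a * e < 2 * (hg + b * e), xg + a * e <= xl & hg + b * e <= hl]) ->
  xm <= xg -> hm <= hg ->
  (forall s, 2 * psum s xg hg <= psum s xl hl + psum s xm hm) ->
  2 * osum k xg hg <= osum k xl hl + osum k xm hm.
Proof.
move=> k1 l1 l2 m1 m2 g1 g2 a0 b0 e00 ge xmg hmg D.
pose ps s e := psum s (xg + a * e) (hg + b * e).
pose F e := osum k xl hl + osum k xm hm - 2 * osum k (xg + a * e) (hg + b * e)
  + 2 * (ps k e * (ps (- 1) e - psum (- 1) xg hg)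
    + ps (- 1) e * (ps k e - psum k xg hg)
    + 2 * (ps (k + 1 / 2) e - psum (k + 1 / 2) xg hg)).
have [dF dFE] : exists d, drv 0 F d.
  eexists; rewrite /F /ps /osum /psum; drv.
have F0 : F 0 = osum k xl hl + osum k xm hm - 2 * osum k xg hg.
  by rewrite /F /ps !mulr0 !addr0 !subrr !mulr0 !addr0 mulr0 addr0.
suff : 0 <= F 0 by rewrite F0; lra.
apply: (limit_ge0 dFE e00) => e e1 e2.
have [h1 h2 h3 h4] := ge e e1 e2.
have ae : 0 <= a * e by rewrite mulr_ge0// ltW.
have be : 0 <= b * e by rewrite mulr_ge0// ltW.
have h5 : xm <= xg + a * e by lra.
have h6 : hm <= hg + b * e by lra.
have [c1 [c2 [c10 c1r c20 c22]]] := osum_interior k1 l1 l2 m1 m2 h1 h2 h3 h4 h5 h6.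
rewrite -!/(ps _ e) in c1r *.
have mono s : 0 <= ps s e - psum s xg hg.
  by rewrite subr_ge0 /ps; apply: psum_le => //; lra.
(* The coefficients [c1] and [c2] depend on [e] in an uncontrolled way, so they are replaced by
   upper bounds that are differentiable in [e]. *)
have low s c c' : 0 <= c -> c <= c' -> - (2 * (c' * (ps s e - psum s xg hg)))
    <= c * (psum s xl hl + psum s xm hm - 2 * ps s e).
  move=> cp cc; have := ler_wpM2r (mono s) cc.
  have : 0 <= psum s xl hl + psum s xm hm - 2 * psum s xg hg by have := D s; lra.
  move=> /(mulr_ge0 cp); lra.
have q1 := low (- 1) (ps k e) (ps k e) (psum_ge0 _ _ _) (lexx _).
have q2 := low k c1 _ c10 c1r.
have q3 := low (k + 1 / 2) c2 2 c20 c22.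
by rewrite /F; lra.
Qed.

(** If [gamma] has exactly two equal coordinates, it is moved into the open chamber along [x] or
    [h], where strict dominance by [lambda] leaves room. It cannot have three, since [gamma]
    strictly dominates [mu]. *)
Lemma osum_convex k xl hl xg hg xm hm : 1 < k ->
  hl <= 2 * xl -> xl <= 2 * hl -> hm <= 2 * xm -> xm <= 2 * hm ->
  hg <= 2 * xg -> xg <= 2 * hg ->
  xg <= xl -> hg <= hl -> xm <= xg -> hm <= hg ->
  (xg, hg) != (xl, hl) -> (xm, hm) != (xg, hg) ->
  (forall s, 2 * psum s xg hg <= psum s xl hl + psum s xm hm) ->
  2 * osum k xg hg <= osum k xl hl + osum k xm hm.
Proof.
move=> k1 l1 l2 m1 m2 g1 g2 xgl hgl xmg hmg gl mg D.
have [g0|g0] := leP (xg + hg) 0.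
  have [x0 h0] : xg = 0 /\ hg = 0 by split; lra.
  have [x1 h1] : xm = 0 /\ hm = 0 by split; lra.
  by move: mg; rewrite x0 h0 x1 h1 eqxx.
have [e1|g1'] := eqVneq hg (2 * xg).
  have xx : xg < xl.
    rewrite lt_neqAle xgl andbT; apply: contraNneq gl => e.
    by apply/eqP; congr pair => //; lra.
  have xg0 : 0 < xg by lra.
  pose e0 := Num.min (xl - xg) xg.
  have e00 : 0 < e0 by rewrite lt_min subr_gt0 xx.
  apply: (@osum_limit k xl hl xg hg xm hm 1 0 e0) => // e ep ee.
  have : e < xl - xg by rewrite (lt_le_trans ee)// ge_min lexx.
  have : e < xg by rewrite (lt_le_trans ee)// ge_min lexx orbT.
  by move=> q1 q2; split; lra.
have [e1|g2'] := eqVneq xg (2 * hg).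
  have xx : hg < hl.
    rewrite lt_neqAle hgl andbT; apply: contraNneq gl => e.
    by apply/eqP; congr pair => //; lra.
  have hg0 : 0 < hg by lra.
  pose e0 := Num.min (hl - hg) hg.
  have e00 : 0 < e0 by rewrite lt_min subr_gt0 xx.
  apply: (@osum_limit k xl hl xg hg xm hm 0 1 e0) => // e ep ee.
  have : e < hl - hg by rewrite (lt_le_trans ee)// ge_min lexx.
  have : e < hg by rewrite (lt_le_trans ee)// ge_min lexx orbT.
  by move=> q1 q2; split; lra.
have h1 : hg < 2 * xg by rewrite lt_neqAle g1'.
have h2 : xg < 2 * hg by rewrite lt_neqAle g2'.
have [c1 [c2 [c10 _ c20 _]]] := osum_interior k1 l1 l2 m1 m2 h1 h2 xgl hgl xmg hmg.
have D' s : 0 <= psum s xl hl + psum s xm hm - 2 * psum s xg hg by have := D s; lra.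
have := mulr_ge0 (psum_ge0 k xg hg) (D' (- 1)).
have := mulr_ge0 c10 (D' k); have := mulr_ge0 c20 (D' (k + 1 / 2)).
lra.
Qed.

(** The sum of [e^(s eta_i - t eta_j)] over ordered pairs of distinct indices; [osum k] is the case
    [s = k], [t = 1]. *)
Definition osum2 s t x h : R := psum s x h * psum (- t) x h - psum (s - t) x h.

Lemma psum_scale c s x h : psum s (c * x) (c * h) = psum (s * c) x h.
Proof. by rewrite /psum; congr (E _ + E _ + E _); ring. Qed.

(** For [0 < t < s], scaling the exponents by [t] reduces to [osum] with [k = s / t]. At [t = 0] the
    function is [2 psum s]. At [t = s] it is a product minus 3, and both factors increase from [mu]
    through [gamma] to [lambda], so the products of increments are nonnegative. *)
Lemma osum2_convex s t xl hl xg hg xm hm : 0 <= t -> t <= s ->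
  hl <= 2 * xl -> xl <= 2 * hl -> hm <= 2 * xm -> xm <= 2 * hm ->
  hg <= 2 * xg -> xg <= 2 * hg ->
  xg <= xl -> hg <= hl -> xm <= xg -> hm <= hg ->
  (xg, hg) != (xl, hl) -> (xm, hm) != (xg, hg) ->
  (forall s, 2 * psum s xg hg <= psum s xl hl + psum s xm hm) ->
  2 * osum2 s t xg hg <= osum2 s t xl hl + osum2 s t xm hm.
Proof.
move=> t0 ts l1 l2 m1 m2 g1 g2 xgl hgl xmg hmg gl mg D.
have p0 x h : psum 0 x h = 3 by rewrite /psum !mul0r expR0; ring.
have [->|tn0] := eqVneq t 0.
  have := D s; rewrite /osum2 !oppr0 !addr0 !p0; lra.
have {}t0 : 0 < t by rewrite lt_neqAle eq_sym tn0.
have [<-|st] := eqVneq t s.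
  rewrite /osum2 subrr !p0.
  have q1 u : 0 <= psum u xl hl - psum u xg hg by rewrite subr_ge0 psum_le.
  have q2 u : 0 <= psum u xg hg - psum u xm hm by rewrite subr_ge0 psum_le.
  have := mulr_ge0 (q1 t) (q1 (- t)); have := mulr_ge0 (q2 t) (q2 (- t)).
  have d1 : 0 <= psum t xl hl + psum t xm hm - 2 * psum t xg hg by have := D t; lra.
  have d2 : 0 <= psum (- t) xl hl + psum (- t) xm hm - 2 * psum (- t) xg hg.
    by have := D (- t); lra.
  have := mulr_ge0 d1 (psum_ge0 (- t) xg hg).
  have := mulr_ge0 (psum_ge0 t xg hg) d2.
  lra.
have {}st : t < s by rewrite lt_neqAle st.
have k1 : 1 < s / t by rewrite ltr_pdivlMr// mul1r.
have osE x h : osum (s / t) (t * x) (t * h) = osum2 s t x h.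
  rewrite /osum /osum2 !psum_scale mulN1r divfK// mulrBl mul1r divfK//.
rewrite -!osE.
have sc u v : u <= v -> t * u <= t * v by move=> uv; rewrite ler_wpM2l// ltW.
have pn x h x' h' : (x, h) != (x', h') -> (t * x, t * h) != (t * x', t * h').
  apply: contraNneq => -[/(mulfI tn0) -> /(mulfI tn0) ->]; exact/eqP.
apply: osum_convex => //; rewrite ?(mulrCA 2 t) ?sc//; try exact: pn.
by move=> u; rewrite !psum_scale; exact: D.
Qed.

Lemma psum_opp s x h : psum s h x = psum (- s) x h.
Proof.
have e1 : - s * x = s * - x by ring.
have e2 : - s * (h - x) = s * (x - h) by ring.
by rewrite /psum e1 e2 mulrNN; ring.
Qed.

(** Negating the exponents exchanges [x] with [h] and [s] with [t], which reduces the case [s < t]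
    to the previous one. *)
Lemma osum2_convex_all s t xl hl xg hg xm hm : 0 <= t -> 0 <= s ->
  hl <= 2 * xl -> xl <= 2 * hl -> hm <= 2 * xm -> xm <= 2 * hm ->
  hg <= 2 * xg -> xg <= 2 * hg ->
  xg <= xl -> hg <= hl -> xm <= xg -> hm <= hg ->
  (xg, hg) != (xl, hl) -> (xm, hm) != (xg, hg) ->
  (forall s, 2 * psum s xg hg <= psum s xl hl + psum s xm hm) ->
  2 * osum2 s t xg hg <= osum2 s t xl hl + osum2 s t xm hm.
Proof.
move=> t0 s0 l1 l2 m1 m2 g1 g2 xgl hgl xmg hmg gl mg D.
have [ts|st] := leP t s; first exact: osum2_convex.
have sw x h : osum2 s t x h = osum2 t s h x.
  by rewrite /osum2 !(psum_opp _ x h) opprK opprB [in RHS]mulrC.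
rewrite !sw; apply: osum2_convex => //; first exact: ltW.
- by apply: contraNneq gl => -[-> ->].
- by apply: contraNneq mg => -[-> ->].
- by move=> u; rewrite !(psum_opp u); exact: D.
Qed.

End RealExponents.

(** * Orbit sums *)

Section Triples.
Variable R : realType.
Implicit Types (eta : triple) (x y z : R).

Let o0 : 'I_3 := ord0.
Let o1 : 'I_3 := inord 1.
Let o2 : 'I_3 := inord 2.

Lemma sum_S3 (F : 'I_3 -> 'I_3 -> 'I_3 -> R) :
  \sum_(s : 'S_3) F (s o0) (s o1) (s o2) =
  F o0 o1 o2 + F o0 o2 o1 + F o1 o0 o2 + F o1 o2 o0 + F o2 o0 o1 + F o2 o1 o0.
Proof.
have n01 : o0 != o1 by rewrite -val_eqE /= inordK.
have n02 : o0 != o2 by rewrite -val_eqE /= inordK.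
have n12 : o1 != o2 by rewrite -val_eqE /= !inordK.
pose l : seq 'S_3 := [:: 1; tperm o1 o2; tperm o0 o1; tperm o0 o1 * tperm o0 o2;
  tperm o0 o2 * tperm o0 o1; tperm o0 o2]%g.
pose ev (s : 'S_3) := (s o0, s o1, s o2).
have evl : map ev l = [:: (o0, o1, o2); (o0, o2, o1); (o1, o0, o2); (o1, o2, o0);
   (o2, o0, o1); (o2, o1, o0)].
  have [n10 n20 n21] : [/\ o1 != o0, o2 != o0 & o2 != o1].
    by split; rewrite eq_sym.
  by rewrite /= /ev !(permM, perm1, tpermL, tpermR, tpermD n10 n20, tpermD n02 n12,
    tpermD n01 n21, tpermL, tpermR).
have lu : uniq l.
  apply: (@map_uniq _ _ ev); rewrite evl /= !inE !xpair_eqE !eqxx.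
  by rewrite ?[o1 == o0]eq_sym ?[o2 == o0]eq_sym ?[o2 == o1]eq_sym
     ?(negbTE n01) ?(negbTE n02) ?(negbTE n12).
(* Six distinct permutations exhaust a group of order 3!. *)
have lall : l =i predT.
  apply/subset_cardP; last exact: subset_predT.
  by rewrite (card_uniqP lu) card_Sn.
rewrite (eq_bigl (mem l)); last by move=> s; rewrite /= lall.
rewrite -big_uniq//=.
rewrite (eq_bigr (fun s => let: (a, b, c) := ev s in F a b c))//.
rewrite -(big_map ev xpredT (fun p => let: (a, b, c) := p in F a b c)) evl.
by rewrite !big_cons big_nil addr0 !addrA.
Qed.

Let nthE eta (i : 'I_3) : tnth eta i = nth 0 eta i.
Proof. exact: tnth_nth. Qed.

Let ordE : [/\ lift ord0 (ord0 : 'I_2) = o1 & lift ord0 (lift ord0 (ord0 : 'I_1)) = o2].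
Proof. by split; apply: val_inj; rewrite /= inordK. Qed.

Lemma labeled_orbit_sumE eta x y z :
  let a := nth 0 eta 0 in let b := nth 0 eta 1 in let c := nth 0 eta 2 in
  labeled_orbit_sum eta [tuple x; y; z] =
  x ^+ a * y ^+ b * z ^+ c + x ^+ a * y ^+ c * z ^+ b
  + x ^+ b * y ^+ a * z ^+ c + x ^+ b * y ^+ c * z ^+ a
  + x ^+ c * y ^+ a * z ^+ b + x ^+ c * y ^+ b * z ^+ a.
Proof.
move=> a b c; have [e1 e2] := ordE.
pose F i j l := x ^+ tnth eta i * y ^+ tnth eta j * z ^+ tnth eta l.
have -> : labeled_orbit_sum eta [tuple x; y; z] =
    \sum_(s : 'S_3) F (s o0) (s o1) (s o2).
  apply: eq_bigr => s _; rewrite !big_ord_recl big_ord0 e1 e2 mulr1 mulrA.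
  by rewrite /F !(tnth_nth 0) /o1 /o2 /= !inordK.
by rewrite sum_S3 /F !nthE /o1 /o2 !inordK.
Qed.

Lemma sum_powE eta (t : R) : \sum_(i < 3) t ^+ tnth eta i =
  t ^+ nth 0 eta 0 + t ^+ nth 0 eta 1 + t ^+ nth 0 eta 2.
Proof.
have [e1 e2] := ordE.
by rewrite !big_ord_recl big_ord0 e1 e2 !nthE /o1 /o2 !inordK// addr0 addrA.
Qed.

Lemma triple_sumE eta :
  triple_sum eta = (nth 0 eta 0 + nth 0 eta 1 + nth 0 eta 2)%N.
Proof.
have [e1 e2] := ordE; rewrite /triple_sum.
by rewrite !big_ord_recl big_ord0 e1 e2 !nthE /o1 /o2 !inordK// addn0 addnA.
Qed.

End Triples.

(** * Passage to logarithmic coordinates *)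

Section Logarithms.
Variable R : realType.
Implicit Types (eta : triple) (x y z : R).
Local Notation E := (@expR R).

(** Centring the exponents at their mean gives the triple [(x, h - x, - h)] of [psum], with
    [x = coord_top] and [h = coord_bot]. *)
Definition coord_top eta : R := (nth 0 eta 0)%:R - (triple_sum eta)%:R / 3.
Definition coord_bot eta : R := (triple_sum eta)%:R / 3 - (nth 0 eta 2)%:R.

Let coord_mid eta : coord_bot eta - coord_top eta
  = (nth 0 eta 1)%:R - (triple_sum eta)%:R / 3.
Proof. by rewrite /coord_bot /coord_top triple_sumE !natrD; field. Qed.

Lemma sum_pow_exp eta (s : R) : \sum_(i < 3) E s ^+ tnth eta i
  = E (s * (triple_sum eta)%:R / 3) * psum s (coord_top eta) (coord_bot eta).
Proof.
rewrite sum_powE -!expRM_natl /psum coord_mid /coord_top /coord_bot !mulrDr -!expRD.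
by congr (E _ + E _ + E _); field.
Qed.

(** Homogeneity splits off the mean exponent. The centred exponents sum to 0, so the exponent of the
    middle variable is eliminated and only [X - Y] and [Y - Z] remain. *)
Lemma labeled_orbit_sum_exp eta (X Y Z : R) :
  labeled_orbit_sum eta [tuple E X; E Y; E Z] =
  E ((triple_sum eta)%:R / 3 * (X + Y + Z))
  * osum2 (X - Y) (Y - Z) (coord_top eta) (coord_bot eta).
Proof.
rewrite labeled_orbit_sumE -!expRM_natl /osum2 /psum coord_mid.
pose a : R := (nth 0 eta 0)%:R; pose b : R := (nth 0 eta 1)%:R.
pose c : R := (nth 0 eta 2)%:R; pose nu : R := (triple_sum eta)%:R / 3.
have nuE : a + b + c = 3 * nu by rewrite /nu triple_sumE !natrD; field.
have -> : - coord_bot eta = c - nu by rewrite /coord_bot -/nu -/c; ring.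
rewrite /coord_top -/nu -/a -/b -/c; clearbody nu a b c.
have cE : c = 3 * nu - a - b by lra.
have diag v : E ((X - Y - (Y - Z)) * v) = E ((X - Y) * v) * E (- (Y - Z) * v).
  by rewrite -expRD; congr expR; ring.
rewrite !diag.
have term u v w : u + v + w = 3 * nu -> E (u * X) * E (v * Y) * E (w * Z)
   = E (nu * (X + Y + Z)) * (E ((X - Y) * (u - nu)) * E (- (Y - Z) * (w - nu))).
  move=> e; rewrite -!expRD; congr expR.
  by rewrite (_ : v = 3 * nu - u - w); [ring|lra].
by rewrite !term; [ring|lra..].
Qed.

Lemma Pfun_perm lambda gamma mu x y z :
  Pfun lambda gamma mu x y z = Pfun lambda gamma mu y x z /\
  Pfun lambda gamma mu x y z = Pfun lambda gamma mu x z y.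
Proof. by rewrite /Pfun !labeled_orbit_sumE; split; ring. Qed.

Lemma Pfun_diag lambda gamma mu (t : R) :
  Pfun lambda gamma mu t 1 1 = 2 * Qfun lambda gamma mu t.
Proof. by rewrite /Pfun /Qfun !labeled_orbit_sumE !sum_powE !expr1n; ring. Qed.

End Logarithms.

(** * Dominance in the centred coordinates *)

Section Comparison.
Variable R : realType.

Lemma coord_chamber eta : weakly_decreasing eta ->
  coord_bot R eta <= 2 * coord_top R eta /\ coord_top R eta <= 2 * coord_bot R eta.
Proof.
move=> d.
have [h1 h2] : (nth 0 eta 1 <= nth 0 eta 0)%N /\ (nth 0 eta 2 <= nth 0 eta 1)%N.
  move: d; rewrite /weakly_decreasing; case: eta => [[|a [|b [|c []]]] //= _].
  by case/and3P.
move: h1 h2; rewrite -!(ler_nat R) /coord_bot /coord_top triple_sumE !natrD => h1 h2.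
by split; lra.
Qed.

Lemma coord_dominates a b : triple_sum a = triple_sum b -> strictly_dominates a b ->
  [/\ coord_top R b <= coord_top R a, coord_bot R b <= coord_bot R a &
    (coord_top R b, coord_bot R b) != (coord_top R a, coord_bot R a)].
Proof.
move=> e /andP[/andP[h1 h2] ne].
have e' := e; rewrite !triple_sumE in e'.
have h3 : (nth 0 a 2 <= nth 0 b 2)%N by rewrite -(leq_add2l (nth 0 b 0 + nth 0 b 1)) -e' leq_add2r.
rewrite /coord_top /coord_bot e; split.
- by rewrite lerD2r ler_nat.
- by rewrite lerD2l lerN2 ler_nat.
apply: contraNneq ne => -[/addIr/eqP + /addrI/oppr_inj/eqP].
rewrite !eqr_nat => /eqP q1 /eqP q3; apply/eqP/val_inj => /=.
have q2 : nth 0 a 1 = nth 0 b 1.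
  by apply/eqP; rewrite -(eqn_add2l (nth 0 a 0)) -(eqn_add2r (nth 0 a 2)) e' q1 q3.
by apply: (@eq_from_nth _ 0); rewrite !size_tuple// => -[|[|[|]]].
Qed.

End Comparison.

Theorem theorem4p3 (R : realType) (lambda gamma mu : triple)
    (lambda_decr : weakly_decreasing lambda)
    (gamma_decr : weakly_decreasing gamma)
    (mu_decr : weakly_decreasing mu)
    (sum_lambda_gamma : triple_sum lambda = triple_sum gamma)
    (sum_gamma_mu : triple_sum gamma = triple_sum mu)
    (lambda_gamma : strictly_dominates lambda gamma)
    (gamma_mu : strictly_dominates gamma mu) :
  (forall x y z : R, 0 < x -> 0 < y -> 0 < z ->
     0 <= Pfun lambda gamma mu x y z) <->
  (forall t : R, 0 < t -> 0 <= Qfun lambda gamma mu t).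
Proof.
split=> [P0 t t0|Q0].
  by have := P0 t 1 1 t0 ltr01 ltr01; rewrite Pfun_diag pmulr_rge0.
have [l1 l2] := coord_chamber R lambda_decr.
have [g1 g2] := coord_chamber R gamma_decr.
have [m1 m2] := coord_chamber R mu_decr.
have [t1 b1 n1] := coord_dominates R sum_lambda_gamma lambda_gamma.
have [t2 b2 n2] := coord_dominates R sum_gamma_mu gamma_mu.
(* This is [Q] at [e^s], divided by the factor that the three triples share because their sums
   agree. *)
have D s : 2 * psum s (coord_top R gamma) (coord_bot R gamma) <=
    psum s (coord_top R lambda) (coord_bot R lambda)
    + psum s (coord_top R mu) (coord_bot R mu).
  have := Q0 _ (expR_gt0 s); rewrite /Qfun !sum_pow_exp sum_lambda_gamma -sum_gamma_mu.
  rewrite mulrCA -mulrDr -mulrBr pmulr_rge0 ?expR_gt0//; lra.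
(* For [x >= y >= z] the parameters [s] and [t] of [osum2] are nonnegative; the symmetry of [Pfun]
   gives the other orders. *)
have ordered (x y z : R) : 0 < z -> z <= y -> y <= x -> 0 <= Pfun lambda gamma mu x y z.
  move=> z0 zy yx; have y0 : 0 < y by exact: lt_le_trans zy.
  have x0 : 0 < x by exact: lt_le_trans yx.
  have ln_ge (u v : R) : 0 < u -> u <= v -> 0 <= ln v - ln u.
    by move=> u0 uv; rewrite subr_ge0 ler_ln ?posrE// (lt_le_trans u0).
  rewrite -(lnK (x0 : x \is Num.pos)) -(lnK (y0 : y \is Num.pos))
    -(lnK (z0 : z \is Num.pos)) /Pfun !labeled_orbit_sum_exp.
  rewrite sum_lambda_gamma -sum_gamma_mu mulrCA -mulrDr -mulrBr pmulr_rge0 ?expR_gt0//.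
  rewrite subr_ge0.
  exact: (osum2_convex_all (ln_ge _ _ z0 zy) (ln_ge _ _ y0 yx)
    l1 l2 m1 m2 g1 g2 t1 b1 t2 b2 n1 n2 D).
move=> x y z x0 y0 z0.
have sw a b c := proj1 (Pfun_perm lambda gamma mu (a : R) b c).
have sw' a b c := proj2 (Pfun_perm lambda gamma mu (a : R) b c).
have sorted2 (a b c : R) : 0 < c -> c <= a -> c <= b -> 0 <= Pfun lambda gamma mu a b c.
  move=> c0 ca cb; have [ab|/ltW ba] := leP a b.
    by rewrite sw; exact: ordered.
  exact: ordered.
have [xy|/ltW yx] := leP x y.
  have [xz|/ltW zx] := leP x z.
    by rewrite sw sw'; exact: sorted2.
  by apply: sorted2 => //; exact: le_trans xy.
have [yz|/ltW zy] := leP y z.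
  by rewrite sw'; exact: sorted2.
by apply: sorted2 => //; exact: le_trans yx.
Qed.
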